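(* Let $k$ be a field and let $g:C\to D$ be a homomorphism of finite dimensional $k$-coalgebras. Let $A=C^*$, $B=D^*$ be the dual algebras, $g^*:B\to A$, $g^*(d^* )=d^*\circ g$, the dual algebra homomorphism, and $R=C_A(B)$. Then $g$ is left codepth two if and only if the algebra homomorphism $g^*:B\to A$ is left depth two; likewise $g$ is right codepth two if and only if $g^*$ is right depth two. Moreover, when $g$ is (left or right) codepth two, the $R$-bialgebroids $\mathrm{End}({}^DC^D)$ and $\mathrm{End}({}_BA_B)$ are anti-isomorphic.
   Context: Tensor products without subscript are over $k$, and Sweedler notation is used. $C^*=\mathrm{Hom}_k(C,k)$ is an algebra under the convolution product $(\phi*\eta)(c)=\phi(c_{(1)})\eta(c_{(2)})$ with unit $\varepsilon_C$; similarly for $D^*$. $A$ is a $B$-bimodule via $g^*$ and $R=C_A(B)=\{r\in A: g^*(b)*r=r*g^*(b)\ \forall b\in B\}$. Codepth two: $C$ is a $D$-$D$-bicomodule ${}^DC^D$ via $c\mapsto g(c_{(1)})\otimes c_{(2)}$ and $c\mapsto c_{(1)}\otimes g(c_{(2)})$. The cotensor product is $C\,\Box_D\,C=\{\sum_ic_i\otimes c_i'\in C\otimes C:\sum_ic_{i(1)}\otimes g(c_{i(2)})\otimes c_i'=\sum_ic_i\otimes g(c'_{i(1)})\otimes c'_{i(2)}\}$. It is a $C$-$C$-bicomodule via $\Delta\otimes\mathrm{id}_C$ and $\mathrm{id}_C\otimes\Delta$, and $C$-comodules become $D$-comodules by corestriction along $g$. The homomorphism $g$ is left (resp. right) codepth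 two if for some positive integer $N$, $C\,\Box_D\,C$ is isomorphic to a direct summand of $C^N$ as $D$-$C$-bicomodules (resp. $C$-$D$-bicomodules). Depth two: an algebra homomorphism $B\to A$ is left (resp. right) depth two if for some positive integer $n$ the natural bimodule $A\otimes_BA$ is isomorphic to a direct summand of $A^n$ as $B$-$A$-bimodules (resp. $A$-$B$-bimodules). The left $R$-bialgebroid $S=\mathrm{End}({}_BA_B)$ (for $A\,|\,B$ left or right depth two): multiplication is composition, the source is $r\mapsto\lambda_r$ (left multiplication), the target is $r\mapsto\rho_r$ (right multiplication), and the bimodule structure is $r\cdot\alpha\cdot s=r\alpha(-)s$. The counit is $\varepsilon_S(\alpha)=\alpha(1_A)$, and the coproduct $\Delta_S(\alpha)=\alpha_{(1)}\otimes\alpha_{(2)}\in S\otimes_RS$ is the unique element with $\alpha_{(1)}(x)\alpha_{(2)}(y)=\alpha(xy)$ for all $x,y\in A$. The right $R$-bialgebroid $\mathrm{End}({}^DC^D)$ of $D$-$D$-bicomodule endomorphisms of $C$ (for $g$ left or right codepth two): multiplication is composition, the source is $s_R(r)(c)=c_{(1)}r(c_{(2)})$, the target is $t_R(r)(c)=r(c_{(1)})c_{(2)}$, and the bimodule structure is $r\cdot\alpha\cdot s=\alpha\circ s_R(s)\circ t_R(r)$. The counit is $\varepsilon(\alpha)=\varepsilon_C\circ\alpha\in R$, and the coproduct $\alpha_{(1)}\otimes\alpha_{(2)}\in\mathrm{End}({}^DC^D)\otimes_R\mathrm{End}({}^DC^D)$ is the unique element with $\alpha_{(1)}(c_{(1)})\otimes\alpha_{(2)}(c_{(2)})=\alpha(c)_{(1)}\otimes\alpha(c)_{(2)}$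 for all $c\in C$. An anti-isomorphism from this right $R$-bialgebroid to the left $R$-bialgebroid $S$ is an anti-isomorphism of algebras which carries $t_R(r)$ to $\lambda_r$ and $s_R(r)$ to $\rho_r$ for all $r\in R$ and is an isomorphism of $R$-corings (an $R$-bimodule isomorphism commuting with coproducts and counits). *)

(* Defs.v *)
From HB Require Import structures.
From mathcomp Require Import all_boot all_order all_algebra.

Set Implicit Arguments.
Unset Strict Implicit.
Unset Printing Implicit Defensive.

Import GRing.Theory.
Local Open Scope ring_scope.

Lemma linfunE (k : fieldType) (V W : vectType k) (f : V -> W) :
  linear f -> linfun f =1 f.
Proof.
move=> fL; pose F : {linear V -> W} :=
  HB.pack f (GRing.isLinear.Build _ _ _ _ _ fL).
exact: (lfunE F).
Qed.

Section Bilin.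

Variables (k : fieldType) (U V W : vectType k).

Definition bilin (f : U -> V -> W) : Prop :=
  (forall v, linear (f^~ v)) /\ (forall u, linear (f u)).

Lemma bilinP (f : U -> V -> W) :
  (forall a u u' v, f (a *: u + u') v = a *: f u v + f u' v) ->
  (forall a u v v', f u (a *: v + v') = a *: f u v + f u v') -> bilin f.
Proof. by move=> fl fr; split=> [v a u u'|u a v v']; rewrite ?fl ?fr. Qed.

Variables (f : U -> V -> W) (fP : bilin f).

Lemma bilinDl u u' v : f (u + u') v = f u v + f u' v.
Proof. by rewrite -[u]scale1r (proj1 fP v) !scale1r. Qed.

Lemma bilinDr u v v' : f u (v + v') = f u v + f u v'.
Proof. by rewrite -[v]scale1r (proj2 fP u) !scale1r. Qed.

Lemma bilin0l v : f 0 v = 0.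
Proof. by apply: (addrI (f 0 v)); rewrite -bilinDl !addr0. Qed.

Lemma bilin0r u : f u 0 = 0.
Proof. by apply: (addrI (f u 0)); rewrite -bilinDr !addr0. Qed.

Lemma bilinZl a u v : f (a *: u) v = a *: f u v.
Proof. by rewrite -[a *: u]addr0 (proj1 fP v) bilin0l addr0. Qed.

Lemma bilinZr a u v : f u (a *: v) = a *: f u v.
Proof. by rewrite -[a *: v]addr0 (proj2 fP u) bilin0r addr0. Qed.

Lemma bilin_suml I (r : seq I) (P : pred I) (F : I -> U) v :
  f (\sum_(i <- r | P i) F i) v = \sum_(i <- r | P i) f (F i) v.
Proof. by apply: (big_morph (f^~ v)) => [x y|]; rewrite ?bilinDl ?bilin0l. Qed.

Lemma bilin_sumr I (r : seq I) (P : pred I) (F : I -> V) u :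
  f u (\sum_(i <- r | P i) F i) = \sum_(i <- r | P i) f u (F i).
Proof. by apply: (big_morph (f u)) => [x y|]; rewrite ?bilinDr ?bilin0r. Qed.

End Bilin.

(* The tensor product over k of two finite dimensional spaces: a tensor is    *)
(* the matrix of its coordinates in the basis of the e_i (x) e_j, where (e_i) *)
(* and (e_j) are the canonical bases of V and W.                              *)
Definition tens (k : fieldType) (V W : vectType k) : Type :=
  'M[k]_(\dim {:V}, \dim {:W}).

HB.instance Definition _ (k : fieldType) (V W : vectType k) :=
  Vector.on (tens V W).

Section Tensor.

Variables (k : fieldType) (V W : vectType k).
Local Notation eV i := ((vbasis {:V})`_i).
Local Notation eW j := ((vbasis {:W})`_j).

Definition tmul (v : V) (w : W) : tens V W :=
  \matrix_(i, j) (coord (vbasis {:V}) i v * coord (vbasis {:W}) j w).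

Lemma tmul_bilin : bilin tmul.
Proof.
apply: bilinP => [a u u' v|a u v v']; apply/matrixP=> i j.
  by rewrite !mxE linearP mulrDl mulrA.
by rewrite !mxE linearP mulrDr mulrCA.
Qed.

Lemma tens_basis (t : tens V W) :
  t = \sum_i \sum_j t i j *: tmul (eV i) (eW j).
Proof.
have fb (X : vectType k) := basis_free (vbasisP {:X}).
apply/matrixP=> i j; rewrite summxE (bigD1 i) //= summxE (bigD1 j) //=.
rewrite !mxE !coord_free // !eqxx !mulr1.
rewrite big1 => [|j' nj]; last first.
  by rewrite !mxE !coord_free // (negbTE nj) !mulr0.
rewrite big1 ?addr0 // => i' ni; rewrite summxE big1 // => j' _.
by rewrite !mxE !coord_free // (negbTE ni) mul0r mulr0.
Qed.

Lemma tens_ind (P : tens V W -> Prop) :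
  (forall v w, P (tmul v w)) -> (forall x y, P x -> P y -> P (x + y)) ->
  forall t, P t.
Proof.
move=> Pm PD t; have P0 : P 0 by rewrite -(bilin0l tmul_bilin 0).
rewrite [t]tens_basis; apply: big_ind => // i _; apply: big_ind => // j _.
by rewrite -(bilinZl tmul_bilin).
Qed.

Variable U : vectType k.

Fact tlift_is_linear (f : V -> W -> U) :
  linear (fun t : tens V W => \sum_i \sum_j t i j *: f (eV i) (eW j)).
Proof.
move=> a t t'; rewrite scaler_sumr -big_split; apply: eq_bigr => i _ /=.
rewrite scaler_sumr -big_split; apply: eq_bigr => j _ /=.
by rewrite !mxE scalerDl scalerA.
Qed.

(* The linear map induced by f : V -> W -> U; it is only meaningful when f is *)
(* bilinear (see tliftE). Sweedler notation f(c_(1), c_(2)) is rendered as    *)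
(* tlift f (comul c).                                                         *)
Definition tlift (f : V -> W -> U) : 'Hom(tens V W, U) :=
  linfun (fun t : tens V W => \sum_i \sum_j t i j *: f (eV i) (eW j)).

Lemma tlift_def f t : tlift f t = \sum_i \sum_j t i j *: f (eV i) (eW j).
Proof. exact: (linfunE (tlift_is_linear f)). Qed.

Lemma tliftE f v w : bilin f -> tlift f (tmul v w) = f v w.
Proof.
move=> fP; rewrite tlift_def.
rewrite {2}[v](coord_vbasis (memvf v)) (bilin_suml fP); apply: eq_bigr => i _.
rewrite (bilinZl fP) [X in f _ X](coord_vbasis (memvf w)) (bilin_sumr fP).
rewrite scaler_sumr; apply: eq_bigr => j _.
by rewrite mxE -scalerA (bilinZr fP).
Qed.

Lemma tens_ext (f g : 'Hom(tens V W, U)) :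
  (forall v w, f (tmul v w) = g (tmul v w)) -> f = g.
Proof.
move=> fg; apply/lfunP; elim/tens_ind => [//|x y fx fy].
by rewrite !linearD /= fx fy.
Qed.

Lemma tlift_eq (f g : V -> W -> U) : f =2 g -> tlift f = tlift g.
Proof.
move=> fg; apply/lfunP=> t; rewrite !tlift_def.
by apply: eq_bigr => i _; apply: eq_bigr => j _; rewrite fg.
Qed.

Lemma tlift_linear (f g : V -> W -> U) a :
  tlift (fun v w => a *: f v w + g v w) = a *: tlift f + tlift g.
Proof.
apply/lfunP=> t; rewrite !lfun_simp !tlift_def scaler_sumr -big_split.
apply: eq_bigr => i _ /=; rewrite scaler_sumr -big_split.
by apply: eq_bigr => j _ /=; rewrite scalerDr !scalerA mulrC.
Qed.

End Tensor.

Notation "v \ox w" := (tmul v w) (at level 40, left associativity) : ring_scope.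

Section TensorMaps.

Variable k : fieldType.
Implicit Types U V W X Y Z : vectType k.

Definition tmap V W X Y (f : 'Hom(V, X)) (g : 'Hom(W, Y)) :
  'Hom(tens V W, tens X Y) := tlift (fun v w => f v \ox g w).

Lemma tmapE V W X Y (f : 'Hom(V, X)) (g : 'Hom(W, Y)) v w :
  tmap f g (v \ox w) = f v \ox g w.
Proof.
rewrite tliftE //; apply: bilinP => [a u u' x|a x u u'].
  by rewrite linearP (proj1 (tmul_bilin _ _)).
by rewrite linearP (proj2 (tmul_bilin _ _)).
Qed.

Lemma tmap_comp V W X Y U Z (f : 'Hom(V, X)) (g : 'Hom(W, Y))
    (f' : 'Hom(X, U)) (g' : 'Hom(Y, Z)) :
  (tmap f' g' \o tmap f g = tmap (f' \o f) (g' \o g))%VF.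
Proof. by apply: tens_ext => v w; rewrite comp_lfunE !tmapE !comp_lfunE. Qed.

Lemma tmap_id V W : tmap \1%VF \1%VF = \1%VF :> 'Hom(tens V W, tens V W).
Proof. by apply: tens_ext => v w; rewrite tmapE !id_lfunE. Qed.

Lemma tmap_bilin V W X Y : bilin (@tmap V W X Y).
Proof.
apply: bilinP => [a f f' g|a f g g']; apply: tens_ext => v w.
  by rewrite !lfun_simp !tmapE !lfun_simp (proj1 (tmul_bilin _ _)).
by rewrite !lfun_simp !tmapE !lfun_simp (proj2 (tmul_bilin _ _)).
Qed.

Definition tassoc V W X :
    'Hom(tens V (tens W X), tens (tens V W) X) :=
  tlift (fun v t => tlift (fun w x => (v \ox w) \ox x) t).

Definition tassocV V W X :
    'Hom(tens (tens V W) X, tens V (tens W X)) :=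
  tlift (fun t x => tlift (fun v w => v \ox (w \ox x)) t).

Lemma tassocE V W X (v : V) (w : W) (x : X) :
  tassoc V W X (v \ox (w \ox x)) = (v \ox w) \ox x.
Proof.
have [b1 b2] := tmul_bilin V W; have [c1 c2] := tmul_bilin (tens V W) X.
rewrite tliftE; last first.
  apply: bilinP => [a u u' t|a u t t']; last exact: linearP.
  rewrite -scale_lfunE -add_lfunE -tlift_linear; congr (fun_of_lfun _ t).
  by apply: tlift_eq => p q; rewrite b1 c1.
rewrite tliftE //.
by apply: bilinP => [a u u' p|a p u u']; rewrite ?b2 ?c1 ?c2.
Qed.

Lemma tassocVE V W X (v : V) (w : W) (x : X) :
  tassocV V W X ((v \ox w) \ox x) = v \ox (w \ox x).
Proof.
have [b1 b2] := tmul_bilin W X; have [c1 c2] := tmul_bilin V (tens W X).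
rewrite tliftE; last first.
  apply: bilinP => [a t t' u|a t u u']; first exact: linearP.
  rewrite -scale_lfunE -add_lfunE -tlift_linear; congr (fun_of_lfun _ t).
  by apply: tlift_eq => p q; rewrite b2 c2.
rewrite tliftE //.
by apply: bilinP => [a u u' p|a p u u']; rewrite ?b1 ?c1 ?c2.
Qed.

Lemma tassocK V W X : cancel (tassoc V W X) (tassocV V W X).
Proof.
move=> t; elim/tens_ind: t => [v s|s s' IH IH']; last by rewrite !linearD /= IH IH'.
elim/tens_ind: s => [w x|s s' IH IH']; first by rewrite tassocE tassocVE.
by rewrite (bilinDr (tmul_bilin _ _)) !linearD /= IH IH'.
Qed.

Lemma tassocVK V W X : cancel (tassocV V W X) (tassoc V W X).
Proof.
move=> t; elim/tens_ind: t => [s x|s s' IH IH']; last by rewrite !linearD /= IH IH'.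
elim/tens_ind: s => [v w|s s' IH IH']; first by rewrite tassocVE tassocE.
by rewrite (bilinDl (tmul_bilin _ _)) !linearD /= IH IH'.
Qed.

End TensorMaps.

(* The quotient V / W of a finite dimensional space, modelled by a complement *)
(* of W; the projection quo_pi is onto with kernel W.                         *)
Definition quo (k : fieldType) (V : vectType k) (W : {vspace V}) : Type :=
  subvs_of (W^C)%VS.

HB.instance Definition _ (k : fieldType) (V : vectType k) (W : {vspace V}) :=
  Vector.on (quo W).

Section Quotient.

Variables (k : fieldType) (V : vectType k) (W : {vspace V}).

Definition quo_pi : 'Hom(V, quo W) :=
  (linfun (vsproj W^C) \o daddv_pi W^C W)%VF.

Definition quo_repr : 'Hom(quo W, V) := linfun vsval.

Lemma quo_reprK : cancel quo_repr quo_pi.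
Proof.
move=> q; rewrite comp_lfunE !lfunE /=.
have dx : (W^C :&: W = 0)%VS by rewrite capvC capv_compl.
by rewrite daddv_pi_id ?subvsP ?vsvalK.
Qed.

Lemma quo_pi_eq0 v : (quo_pi v == 0) = (v \in W).
Proof.
have dx : (W^C :&: W = 0)%VS by rewrite capvC capv_compl.
have dv := daddv_pi_add dx.
rewrite comp_lfunE lfunE /= -val_eqE /= vsprojK ?memv_pi //.
have {}dv : daddv_pi W^C W v + daddv_pi W W^C v = v.
  by apply: dv; rewrite addvC addv_complf memvf.
apply/eqP/idP => [v0|vW]; first by rewrite -dv v0 add0r memv_pi.
apply/eqP; rewrite -memv0 -dx memv_cap memv_pi /=.
by rewrite -(rpredDr _ (memv_pi W W^C v)) dv.
Qed.

Lemma quo_pi_eqP v v' : reflect (quo_pi v = quo_pi v') (v - v' \in W).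
Proof. by rewrite -quo_pi_eq0 linearB subr_eq0; apply: eqP. Qed.

Lemma quo_piK v : quo_repr (quo_pi v) - v \in W.
Proof. by apply/quo_pi_eqP; rewrite quo_reprK. Qed.

End Quotient.

HB.mixin Record isCoalgebra (k : fieldType) C of Vector k C := {
  comul : 'Hom(C, tens C C);
  counit : 'Hom(C, k^o);
  comulA : (tmap comul \1 \o comul = tassoc C C C \o tmap \1 comul \o comul)%VF;
  counitl : (tlift (fun a b => (counit a : k) *: b) \o comul = \1)%VF;
  counitr : (tlift (fun a b => (counit b : k) *: a) \o comul = \1)%VF
}.

#[short(type="coalgType")]
HB.structure Definition Coalgebra (k : fieldType) :=
  { C of Vector k C & isCoalgebra k C }.

Record coalgHom (k : fieldType) (C D : coalgType k) := CoalgHom {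
  coalg_fun :> 'Hom(C, D);
  coalg_comul : (tmap coalg_fun coalg_fun \o comul = comul \o coalg_fun)%VF;
  coalg_counit : (counit \o coalg_fun = counit)%VF
}.

(* Finite dimensional associative unital k-algebras. The algebra structures   *)
(* of the library exclude 1 = 0, which occurs here as the dual of the zero    *)
(* coalgebra.                                                                 *)
HB.mixin Record isFdAlgebra (k : fieldType) A of Vector k A := {
  amul : A -> A -> A;
  aone : A;
  amul_bilin : bilin amul;
  amulA : associative amul;
  amul1l : left_id aone amul;
  amul1r : right_id aone amul
}.

#[short(type="fdAlgType")]
HB.structure Definition FdAlgebra (k : fieldType) :=
  { A of Vector k A & isFdAlgebra k A }.

Notation "x ** y" := (amul x y) (at level 40, left associativity) : ring_scope.

Record algHom (k : fieldType) (B A : fdAlgType k) := AlgHom {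
  alg_fun :> 'Hom(B, A);
  alg_fun1 : alg_fun aone = aone;
  alg_funM : {morph alg_fun : x y / x ** y}
}.

Section Ids.

Variables (k : fieldType) (C : coalgType k) (A : fdAlgType k).

Fact coalg_id_comul : (tmap \1 \1 \o comul = comul \o \1 :> 'Hom(C, _))%VF.
Proof. by rewrite tmap_id comp_lfun1l comp_lfun1r. Qed.

Definition coalg_id : coalgHom C C :=
  CoalgHom coalg_id_comul (comp_lfun1r counit).

Fact alg_id1 : \1%VF (aone : A) = aone. Proof. exact: id_lfunE. Qed.
Fact alg_idM : {morph (\1%VF : 'End(A)) : x y / x ** y}.
Proof. by move=> x y; rewrite !id_lfunE. Qed.

Definition alg_id : algHom A A := AlgHom alg_id1 alg_idM.

End Ids.

Definition dual (k : fieldType) (C : coalgType k) : Type := 'Hom(C, k^o).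

HB.instance Definition _ (k : fieldType) (C : coalgType k) :=
  Vector.on (dual C).

Section Dual.

Variables (k : fieldType) (C : coalgType k).
Implicit Types (phi eta : dual C) (c : C).

Definition conv phi eta : dual C :=
  (tlift (fun a b => phi a * eta b : k^o) \o comul)%VF.

Definition dual1 : dual C := counit.

Lemma conv_lift_bilin phi eta : bilin (fun a b => phi a * eta b : k^o).
Proof.
apply: bilinP => [a x y z|a z x y]; rewrite linearP /=.
  by rewrite mulrDl -mulrA.
by rewrite mulrDr mulrCA.
Qed.

Lemma comulAE c : tmap comul \1%VF (comul c) =
  tassoc C C C (tmap \1%VF comul (comul c)).
Proof. by have /lfunP/(_ c) := @comulA k C; rewrite !comp_lfunE. Qed.

Lemma convA : associative conv.
Proof.
move=> f g h; apply/lfunP=> c; rewrite !comp_lfunE.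
pose F : 'Hom(tens (tens C C) C, k^o) := tlift
  (fun t b => tlift (fun x y => f x * g y : k^o) t * h b : k^o).
have FP : bilin
    (fun t b => tlift (fun x y => f x * g y : k^o) t * h b : k^o).
  apply: bilinP => [a x y z|a z x y]; rewrite linearP /=.
    by rewrite mulrDl -mulrA.
  by rewrite mulrDr mulrCA.
transitivity (F (tassoc C C C (tmap \1%VF comul (comul c)))).
  elim/tens_ind: (comul c) => [a b|x y /= IHx IHy]; last first.
    by rewrite !linearD /= IHx IHy.
  rewrite (tliftE _ _ (conv_lift_bilin _ _)) tmapE id_lfunE /= comp_lfunE.
  elim/tens_ind: (comul b) => [p q|x y /= IHx IHy]; last first.
    by rewrite (bilinDr (tmul_bilin _ _)) !linearD /= mulrDr IHx IHy.
  rewrite tassocE /F (tliftE _ _ FP) !(tliftE _ _ (conv_lift_bilin _ _)).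
  exact: mulrA.
rewrite -comulAE.
elim/tens_ind: (comul c) => [a b|x y /= IHx IHy]; last first.
  by rewrite !linearD /= IHx IHy.
rewrite tmapE id_lfunE /F (tliftE _ _ FP).
by rewrite (tliftE _ _ (conv_lift_bilin _ _)) comp_lfunE.
Qed.

Lemma conv1l : left_id dual1 conv.
Proof.
move=> f; apply/lfunP=> c; rewrite comp_lfunE.
have /lfunP/(_ c) := @counitl k C; rewrite comp_lfunE id_lfunE => {2}<-.
elim/tens_ind: (comul c) => [a b|x y /= IHx IHy]; last first.
  by rewrite !linearD /= IHx IHy.
rewrite (tliftE _ _ (conv_lift_bilin _ _)) tliftE ?linearZ //.
by apply: bilinP => [u x y z|u z x y]; rewrite ?linearP /= ?scalerDl ?scalerA.
Qed.

Lemma conv1r : right_id dual1 conv.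
Proof.
move=> f; apply/lfunP=> c; rewrite comp_lfunE.
have /lfunP/(_ c) := @counitr k C; rewrite comp_lfunE id_lfunE => {2}<-.
elim/tens_ind: (comul c) => [a b|x y /= IHx IHy]; last first.
  by rewrite !linearD /= IHx IHy.
rewrite (tliftE _ _ (conv_lift_bilin _ _)) tliftE ?linearZ /= 1?mulrC //.
by apply: bilinP => [u x y z|u z x y]; rewrite ?linearP /= ?scalerDl ?scalerA.
Qed.

Lemma conv_bilin : bilin conv.
Proof.
apply: bilinP => [a x y z|a z x y]; apply/lfunP=> c; rewrite !lfun_simp;
  elim/tens_ind: (comul c) => [p q|u v /= IHx IHy];
  try by [rewrite !linearD /= IHx IHy addrACA -scalerDr].
  by rewrite !(tliftE _ _ (conv_lift_bilin _ _)) !lfun_simp mulrDl scalerAl.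
by rewrite !(tliftE _ _ (conv_lift_bilin _ _)) !lfun_simp mulrDr scalerAr.
Qed.

HB.instance Definition _ :=
  isFdAlgebra.Build k (dual C) conv_bilin convA conv1l conv1r.

End Dual.

Section DualHom.

Variables (k : fieldType) (C D : coalgType k) (g : coalgHom C D).

Fact dual_map_is_linear :
  linear (fun d : dual D => (d \o g)%VF : dual C).
Proof. by move=> a x y; rewrite comp_lfunDl -comp_lfunZl. Qed.

Definition dual_map : 'Hom(dual D, dual C) :=
  linfun (fun d : dual D => (d \o g)%VF : dual C).

Lemma dual_mapE d : dual_map d = (d \o g)%VF.
Proof. exact: (linfunE dual_map_is_linear). Qed.

Fact dual_map1 : dual_map aone = aone.
Proof. by rewrite dual_mapE; apply: coalg_counit. Qed.

Fact dual_mapM : {morph dual_map : x y / x ** y}.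
Proof.
move=> x y; rewrite !dual_mapE; apply/lfunP=> c; rewrite !comp_lfunE.
have /lfunP/(_ c) := coalg_comul g; rewrite !comp_lfunE => <-.
elim/tens_ind: (comul c) => [a b|u v /= IHx IHy]; last first.
  by rewrite !linearD /= IHx IHy.
by rewrite tmapE !(tliftE _ _ (conv_lift_bilin _ _)) !comp_lfunE.
Qed.

Definition dual_hom : algHom (dual D) (dual C) :=
  AlgHom dual_map1 dual_mapM.

End DualHom.


Section RelativeTensor.

Variables (k : fieldType) (M L N U : vectType k).
Variables (ra : M -> L -> M) (la : L -> N -> N).

(* M (x)_L N is the coequalizer of the two maps M (x) L (x) N -> M (x) N.     *)
Definition bal_map : 'Hom(tens (tens M L) N, tens M N) :=
  (tmap (tlift ra) \1 - (tmap \1 (tlift la) \o tassocV M L N))%VF.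

Definition rtens : Type := quo (limg bal_map).

HB.instance Definition _ := Vector.on rtens.

Definition rtmul (m : M) (n : N) : rtens := quo_pi _ (m \ox n).

(* The map induced on M (x)_L N by a bilinear L-balanced f (see rliftE).      *)
Definition rlift (f : M -> N -> U) : 'Hom(rtens, U) :=
  (tlift f \o quo_repr (limg bal_map))%VF.

Hypotheses (raP : bilin ra) (laP : bilin la).

Lemma bal_mapE m l n :
  bal_map ((m \ox l) \ox n) = ra m l \ox n - m \ox la l n.
Proof.
by rewrite !lfun_simp !tmapE tassocVE tmapE !id_lfunE !tliftE.
Qed.

Lemma rtmul_bal m l n : rtmul (ra m l) n = rtmul m (la l n).
Proof. by apply/quo_pi_eqP; rewrite -bal_mapE memv_img ?memvf. Qed.

Lemma rtmul_bilin : bilin rtmul.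
Proof.
apply: bilinP => [a u u' v|a u v v']; rewrite /rtmul.
  by rewrite (proj1 (tmul_bilin _ _)) linearP.
by rewrite (proj2 (tmul_bilin _ _)) linearP.
Qed.

Lemma rlift_pi (f : M -> N -> U) t : bilin f ->
  (forall m l n, f (ra m l) n = f m (la l n)) ->
  rlift f (quo_pi (limg bal_map) t) = tlift f t.
Proof.
move=> fP fbal; rewrite comp_lfunE; apply/eqP; rewrite -subr_eq0 -linearB /=.
have /memv_imgP[s _ ->] := quo_piK (limg bal_map) t.
apply/eqP; elim/tens_ind: s => [s n|x y /= IHx IHy]; last first.
  by rewrite !linearD /= IHx IHy addr0.
elim/tens_ind: s => [m l|x y /= IHx IHy]; last first.
  by rewrite (bilinDl (tmul_bilin _ _)) !linearD /= IHx IHy addr0.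
by rewrite bal_mapE linearB /= !tliftE // fbal subrr.
Qed.

Lemma rliftE (f : M -> N -> U) m n : bilin f ->
  (forall m l n, f (ra m l) n = f m (la l n)) -> rlift f (rtmul m n) = f m n.
Proof. by move=> fP fbal; rewrite rlift_pi // tliftE. Qed.

End RelativeTensor.

Record is_bimod (k : fieldType) (B A : fdAlgType k) (M : vectType k)
    (la : B -> M -> M) (ra : M -> A -> M) : Prop := IsBimod {
  is_lact_bilin : bilin la;
  is_ract_bilin : bilin ra;
  is_lactA : forall b b' m, la (b ** b') m = la b (la b' m);
  is_lact1 : forall m, la aone m = m;
  is_ractA : forall m a a', ra m (a ** a') = ra (ra m a) a';
  is_ract1 : forall m, ra m aone = m;
  is_lractA : forall b m a, ra (la b m) a = la b (ra m a)
}.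

Record bimod (k : fieldType) (B A : fdAlgType k) := Bimod {
  bimod_sort :> vectType k;
  lact : B -> bimod_sort -> bimod_sort;
  ract : bimod_sort -> A -> bimod_sort;
  bimodP : is_bimod lact ract
}.

Section BimodTheory.

Variables (k : fieldType) (B A : fdAlgType k) (M : bimod B A).

Lemma lact_bilin : bilin (@lact _ _ _ M).
Proof. exact: is_lact_bilin (bimodP M). Qed.

Lemma ract_bilin : bilin (@ract _ _ _ M).
Proof. exact: is_ract_bilin (bimodP M). Qed.

Lemma lactA b b' (m : M) : lact (b ** b') m = lact b (lact b' m).
Proof. exact: is_lactA (bimodP M) _ _ _. Qed.

Lemma lact1 (m : M) : lact aone m = m.
Proof. exact: is_lact1 (bimodP M) _. Qed.

Lemma ractA (m : M) a a' : ract m (a ** a') = ract (ract m a) a'.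
Proof. exact: is_ractA (bimodP M) _ _ _. Qed.

Lemma ract1 (m : M) : ract m aone = m.
Proof. exact: is_ract1 (bimodP M) _. Qed.

Lemma lractA b (m : M) a : ract (lact b m) a = lact b (ract m a).
Proof. exact: is_lractA (bimodP M) _ _ _. Qed.

End BimodTheory.

Section Bimodules.

Variables (k : fieldType) (B A : fdAlgType k).
Implicit Types M N : bimod B A.

Definition bimod_hom M N (phi : 'Hom(M, N)) : Prop :=
  (forall b m, phi (lact b m) = lact b (phi m)) /\
  (forall m a, phi (ract m a) = ract (phi m) a).

Definition bimod_iso M N : Prop :=
  exists phi : 'Hom(M, N), bijective phi /\ bimod_hom phi.

Definition bimod_stable M (P : {vspace M}) : Prop :=
  (forall b m, m \in P -> lact b m \in P) /\
  (forall m a, m \in P -> ract m a \in P).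

Section Sub.

Variables (M : bimod B A) (P : {vspace M}) (PM : bimod_stable P).

Definition sub_lact (b : B) (m : subvs_of P) : subvs_of P :=
  vsproj P (lact b (vsval m)).
Definition sub_ract (m : subvs_of P) (a : A) : subvs_of P :=
  vsproj P (ract (vsval m) a).

Lemma vsval_sub_lact b m : vsval (sub_lact b m) = lact b (vsval m).
Proof. by rewrite vsprojK //; apply: (proj1 PM); apply: subvsP. Qed.

Lemma vsval_sub_ract m a : vsval (sub_ract m a) = ract (vsval m) a.
Proof. by rewrite vsprojK //; apply: (proj2 PM); apply: subvsP. Qed.

Fact sub_lact_bilin : bilin sub_lact.
Proof.
apply: bilinP => [a u u' v|a u v v']; rewrite /sub_lact.
  by rewrite (proj1 (lact_bilin _)) linearP.
by rewrite linearP /= (proj2 (lact_bilin _)) linearP.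
Qed.

Fact sub_ract_bilin : bilin sub_ract.
Proof.
apply: bilinP => [a u u' v|a u v v']; rewrite /sub_ract.
  by rewrite linearP /= (proj1 (ract_bilin _)) linearP.
by rewrite (proj2 (ract_bilin _)) linearP.
Qed.

Fact sub_is_bimod : is_bimod sub_lact sub_ract.
Proof.
apply: (IsBimod sub_lact_bilin sub_ract_bilin) => *; apply: val_inj;
  rewrite /= ?(vsval_sub_lact, vsval_sub_ract).
- exact: lactA.
- exact: lact1.
- exact: ractA.
- exact: ract1.
- exact: lractA.
Qed.

Definition sub_bimod : bimod B A :=
  Bimod sub_is_bimod.

End Sub.

Section Quo.

Variables (M : bimod B A) (P : {vspace M}) (PM : bimod_stable P).

Definition quo_lact (b : B) (m : quo P) : quo P :=
  quo_pi P (lact b (quo_repr P m)).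
Definition quo_ract (m : quo P) (a : A) : quo P :=
  quo_pi P (ract (quo_repr P m) a).

Lemma quo_lact_pi b m : quo_lact b (quo_pi P m) = quo_pi P (lact b m).
Proof.
apply/quo_pi_eqP.
have lB x y : lact b x - lact b y = lact b (x - y).
  by rewrite -!scaleN1r (bilinDr (lact_bilin _)) (bilinZr (lact_bilin _)).
by rewrite lB; apply: (proj1 PM); apply: quo_piK.
Qed.

Lemma quo_ract_pi m a : quo_ract (quo_pi P m) a = quo_pi P (ract m a).
Proof.
apply/quo_pi_eqP.
have rB x y : ract x a - ract y a = ract (x - y) a.
  by rewrite -!scaleN1r (bilinDl (ract_bilin _)) (bilinZl (ract_bilin _)).
by rewrite rB; apply: (proj2 PM); apply: quo_piK.
Qed.

Fact quo_lact_bilin : bilin quo_lact.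
Proof.
apply: bilinP => [a u u' v|a u v v']; rewrite /quo_lact.
  by rewrite (proj1 (lact_bilin _)) linearP.
by rewrite linearP /= (proj2 (lact_bilin _)) linearP.
Qed.

Fact quo_ract_bilin : bilin quo_ract.
Proof.
apply: bilinP => [a u u' v|a u v v']; rewrite /quo_ract.
  by rewrite linearP /= (proj1 (ract_bilin _)) linearP.
by rewrite (proj2 (ract_bilin _)) linearP.
Qed.

Fact quo_is_bimod : is_bimod quo_lact quo_ract.
Proof.
apply: (IsBimod quo_lact_bilin quo_ract_bilin).
- by move=> b b' m; rewrite [quo_lact b' m]/quo_lact quo_lact_pi -lactA.
- by move=> m; rewrite /quo_lact lact1 quo_reprK.
- by move=> m a a'; rewrite [quo_ract m a]/quo_ract quo_ract_pi -ractA.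
- by move=> m; rewrite /quo_ract ract1 quo_reprK.
by move=> b m a; rewrite [quo_lact b m]/quo_lact quo_ract_pi lractA -quo_lact_pi.
Qed.

Definition quo_bimod : bimod B A :=
  Bimod quo_is_bimod.

End Quo.

Section Pow.

Variables (M : bimod B A) (n : nat).

Definition pow_lact (b : B) (f : {ffun 'I_n -> M}) : {ffun 'I_n -> M} :=
  [ffun i => lact b (f i)].
Definition pow_ract (f : {ffun 'I_n -> M}) (a : A) : {ffun 'I_n -> M} :=
  [ffun i => ract (f i) a].

Fact pow_lact_bilin : bilin pow_lact.
Proof.
apply: bilinP => [a u u' v|a u v v']; apply/ffunP=> i; rewrite !ffunE.
  exact: (proj1 (lact_bilin _)).
exact: (proj2 (lact_bilin _)).
Qed.

Fact pow_ract_bilin : bilin pow_ract.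
Proof.
apply: bilinP => [a u u' v|a u v v']; apply/ffunP=> i; rewrite !ffunE.
  exact: (proj1 (ract_bilin _)).
exact: (proj2 (ract_bilin _)).
Qed.

Fact pow_is_bimod : is_bimod pow_lact pow_ract.
Proof.
apply: (IsBimod pow_lact_bilin pow_ract_bilin) => *; apply/ffunP=> i;
  rewrite !ffunE.
- exact: lactA.
- exact: lact1.
- exact: ractA.
- exact: ract1.
- exact: lractA.
Qed.

Definition pow_bimod : bimod B A :=
  Bimod pow_is_bimod.

End Pow.

Definition bimod_summand M N : Prop :=
  exists (P Q : {vspace N}) (PN : bimod_stable P),
    [/\ bimod_stable Q, (P + Q = fullv)%VS, (P :&: Q = 0)%VS
      & bimod_iso M (sub_bimod PN)].

Definition bimod_end M : {vspace 'End(M)} :=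
  (lker (linfun (fun alpha : 'End(M) =>
     tlift (fun b m => alpha (lact b m) - lact b (alpha m)))) :&:
   lker (linfun (fun alpha : 'End(M) =>
     tlift (fun m a => alpha (ract m a) - ract (alpha m) a))))%VS.

Lemma bimod_endP M (alpha : 'End(M)) :
  alpha \in bimod_end M <-> bimod_hom alpha.
Proof.
have [lb rb] := (lact_bilin M, ract_bilin M).
have lP (al : 'End(M)) : bilin (fun b m => al (lact b m) - lact b (al m)).
  apply: bilinP => [a x y z|a z x y].
    by rewrite !(proj1 lb) linearP opprD addrACA scalerBr.
  by rewrite linearP !(proj2 lb) linearP opprD addrACA scalerBr.
have rP (al : 'End(M)) : bilin (fun m b => al (ract m b) - ract (al m) b).
  apply: bilinP => [a x y z|a z x y].
    by rewrite linearP !(proj1 rb) linearP opprD addrACA scalerBr.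
  by rewrite !(proj2 rb) linearP opprD addrACA scalerBr.
have lL : linear (fun alpha : 'End(M) =>
     tlift (fun b m => alpha (lact b m) - lact b (alpha m))).
  move=> a x y; rewrite -tlift_linear; apply: tlift_eq => b m.
  rewrite !lfun_simp (bilinDr lb) (bilinZr lb).
  by rewrite opprD addrACA scalerBr.
have rL : linear (fun alpha : 'End(M) =>
     tlift (fun m a => alpha (ract m a) - ract (alpha m) a)).
  move=> a x y; rewrite -tlift_linear; apply: tlift_eq => b m.
  rewrite !lfun_simp (bilinDl rb) (bilinZl rb).
  by rewrite opprD addrACA scalerBr.
rewrite memv_cap !memv_ker (linfunE lL) (linfunE rL) /=.
split=> [/andP[/eqP l0 /eqP r0]|[l0 r0]].
  split=> x y; apply/eqP; rewrite -subr_eq0.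
    by rewrite -(tliftE _ _ (lP alpha)) l0 zero_lfunE.
  by rewrite -(tliftE _ _ (rP alpha)) r0 zero_lfunE.
apply/andP; split; apply/eqP/tens_ext=> x y; rewrite tliftE // zero_lfunE.
  by rewrite l0 subrr.
by rewrite r0 subrr.
Qed.

End Bimodules.

Section Coherence.

Variable k : fieldType.
Implicit Types U V W X Y Z : vectType k.

Lemma tmap_compE V W X Y U Z (f : 'Hom(V, X)) (g : 'Hom(W, Y))
    (f' : 'Hom(X, U)) (g' : 'Hom(Y, Z)) t :
  tmap f' g' (tmap f g t) = tmap (f' \o f) (g' \o g) t.
Proof. by rewrite -tmap_comp comp_lfunE. Qed.

Lemma tmap_splitl V W X Y U (f : 'Hom(V, X)) (f' : 'Hom(X, U))
    (g : 'Hom(W, Y)) t :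
  tmap (f' \o f) g t = tmap f' g (tmap f \1 t).
Proof. by rewrite tmap_compE comp_lfun1r. Qed.

Lemma tmap_splitr V W X Y U (f : 'Hom(V, X)) (g : 'Hom(W, Y))
    (g' : 'Hom(Y, U)) t :
  tmap f (g' \o g) t = tmap f g' (tmap \1 g t).
Proof. by rewrite tmap_compE comp_lfun1r. Qed.

Lemma tassoc_nat U V W X Y Z (f : 'Hom(U, X)) (g : 'Hom(V, Y))
    (h : 'Hom(W, Z)) t :
  tassoc X Y Z (tmap f (tmap g h) t) = tmap (tmap f g) h (tassoc U V W t).
Proof.
elim/tens_ind: t => [u s|x y /= IHx IHy]; last by rewrite !linearD /= IHx IHy.
elim/tens_ind: s => [v w|x y /= IHx IHy]; last first.
  by rewrite (bilinDr (tmul_bilin _ _)) !linearD /= IHx IHy.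
by rewrite !(tmapE, tassocE).
Qed.

Lemma tassocV_nat U V W X Y Z (f : 'Hom(U, X)) (g : 'Hom(V, Y))
    (h : 'Hom(W, Z)) t :
  tassocV X Y Z (tmap (tmap f g) h t) = tmap f (tmap g h) (tassocV U V W t).
Proof.
by apply: (can_inj (@tassocK _ X Y Z)); rewrite tassocVK tassoc_nat tassocVK.
Qed.

Lemma pentagon U V W X (t : tens U (tens V (tens W X))) :
  tmap (tassoc U V W) \1 (tassoc U (tens V W) X (tmap \1 (tassoc V W X) t)) =
  tassoc (tens U V) W X (tassoc U V (tens W X) t).
Proof.
elim/tens_ind: t => [u s|x y /= IHx IHy]; last by rewrite !linearD /= IHx IHy.
elim/tens_ind: s => [v s|x y /= IHx IHy]; last first.
  by rewrite (bilinDr (tmul_bilin _ _)) !linearD /= IHx IHy.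
elim/tens_ind: s => [w x|x y /= IHx IHy]; last first.
  by rewrite !(bilinDr (tmul_bilin _ _)) !linearD /= IHx IHy.
by rewrite !(tmapE, tassocE, id_lfunE).
Qed.

Lemma pentagonV U V W X (t : tens (tens U (tens V W)) X) :
  tassoc U V (tens W X) (tmap \1 (tassocV V W X) (tassocV U (tens V W) X t)) =
  tassocV (tens U V) W X (tmap (tassoc U V W) \1 t).
Proof.
elim/tens_ind: t => [s u|x y /= IHx IHy]; last by rewrite !linearD /= IHx IHy.
elim/tens_ind: s => [v s|x y /= IHx IHy]; last first.
  by rewrite (bilinDl (tmul_bilin _ _)) !linearD /= IHx IHy.
elim/tens_ind: s => [w x|x y /= IHx IHy]; last first.
  rewrite !(bilinDr (tmul_bilin _ _)) (bilinDl (tmul_bilin _ _)).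
  by rewrite !linearD /= IHx IHy.
by rewrite !(tmapE, tassocE, tassocVE, id_lfunE).
Qed.

Lemma pentagonM U V W X (t : tens (tens U V) (tens W X)) :
  tassoc U (tens V W) X (tmap \1 (tassoc V W X) (tassocV U V (tens W X) t)) =
  tmap (tassocV U V W) \1 (tassoc (tens U V) W X t).
Proof.
elim/tens_ind: t => [s r|x y /= IHx IHy]; last by rewrite !linearD /= IHx IHy.
elim/tens_ind: s => [u v|x y /= IHx IHy]; last first.
  by rewrite (bilinDl (tmul_bilin _ _)) !linearD /= IHx IHy.
elim/tens_ind: r => [w x|x y /= IHx IHy]; last first.
  by rewrite !(bilinDr (tmul_bilin _ _)) !linearD /= IHx IHy.
by rewrite !(tmapE, tassocE, tassocVE, id_lfunE).
Qed.

End Coherence.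

Section JointSplit.

Variables (k : fieldType) (I : finType).
Implicit Types V X M : vectType k.

Definition jsplit X M (j : I -> 'Hom(X, M)) : Prop :=
  exists r : I -> 'Hom(M, X), (\sum_i (r i \o j i)%VF) = \1%VF.

Lemma jsplit_inj X M (j : I -> 'Hom(X, M)) x y :
  jsplit j -> (forall i, j i x = j i y) -> x = y.
Proof.
case=> r jr xy; have id_j u : u = \sum_i r i (j i u).
  rewrite -[LHS]id_lfunE -jr sum_lfunE.
  by apply: eq_bigr => i _; rewrite comp_lfunE.
by rewrite (id_j x) (id_j y); apply: eq_bigr => i _; rewrite xy.
Qed.

Lemma jsplitl V X M (j : I -> 'Hom(X, M)) :
  jsplit j -> jsplit (fun i => tmap (\1%VF : 'End(V)) (j i)).
Proof.
case=> r jr; exists (fun i => tmap \1%VF (r i)).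
rewrite -tmap_id -jr (bilin_sumr (tmap_bilin _ _ _ _)).
by apply: eq_bigr => i _; rewrite tmap_comp comp_lfun1l.
Qed.

Lemma jsplitr V X M (j : I -> 'Hom(X, M)) :
  jsplit j -> jsplit (fun i => tmap (j i) (\1%VF : 'End(V))).
Proof.
case=> r jr; exists (fun i => tmap (r i) \1%VF).
rewrite -tmap_id -jr (bilin_suml (tmap_bilin _ _ _ _)).
by apply: eq_bigr => i _; rewrite tmap_comp comp_lfun1l.
Qed.

End JointSplit.

Section Counit.

Variables (k : fieldType) (D : coalgType k) (M : vectType k).

Definition tcounitl : 'Hom(tens D M, M) :=
  tlift (fun d m => (counit d : k) *: m).
Definition tcounitr : 'Hom(tens M D, M) :=
  tlift (fun m d => (counit d : k) *: m).

Lemma tcounitlE d m : tcounitl (d \ox m) = (counit d : k) *: m.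
Proof.
rewrite tliftE //; apply: bilinP => [a x y z|a z x y].
  by rewrite linearP /= scalerDl scalerA.
by rewrite scalerDr !scalerA mulrC.
Qed.

Lemma tcounitrE d m : tcounitr (m \ox d) = (counit d : k) *: m.
Proof.
rewrite tliftE //; apply: bilinP => [a x y z|a z x y].
  by rewrite scalerDr !scalerA mulrC.
by rewrite linearP /= scalerDl scalerA.
Qed.

End Counit.

Record is_bicomod (k : fieldType) (D E : coalgType k) (M : vectType k)
    (l : 'Hom(M, tens D M)) (r : 'Hom(M, tens M E)) : Prop := IsBicomod {
  is_lcoA : (tmap comul \1 \o l = tassoc D D M \o tmap \1 l \o l)%VF;
  is_lco1 : (tcounitl D M \o l = \1)%VF;
  is_rcoA : (tmap r \1 \o r = tassoc M E E \o tmap \1 comul \o r)%VF;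
  is_rco1 : (tcounitr E M \o r = \1)%VF;
  is_lrco : (tmap l \1 \o r = tassoc D M E \o tmap \1 r \o l)%VF
}.

Record bicomod (k : fieldType) (D E : coalgType k) := Bicomod {
  bicomod_sort :> vectType k;
  lco : 'Hom(bicomod_sort, tens D bicomod_sort);
  rco : 'Hom(bicomod_sort, tens bicomod_sort E);
  bicomodP : is_bicomod lco rco
}.

Section BicomodTheory.

Variables (k : fieldType) (D E : coalgType k) (M : bicomod D E) (m : M).

Lemma lcoA : (tmap comul \1 \o lco M = tassoc D D M \o tmap \1 (lco M) \o lco M)%VF.
Proof. exact: is_lcoA (bicomodP M). Qed.

Lemma lco1 : (tcounitl D M \o lco M = \1)%VF.
Proof. exact: is_lco1 (bicomodP M). Qed.

Lemma rcoA : (tmap (rco M) \1 \o rco M = tassoc M E E \o tmap \1 comul \o rco M)%VF.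
Proof. exact: is_rcoA (bicomodP M). Qed.

Lemma rco1 : (tcounitr E M \o rco M = \1)%VF.
Proof. exact: is_rco1 (bicomodP M). Qed.

Lemma lrco : (tmap (lco M) \1 \o rco M = tassoc D M E \o tmap \1 (rco M) \o lco M)%VF.
Proof. exact: is_lrco (bicomodP M). Qed.

Lemma lcoAE : tmap comul \1%VF (lco M m) =
  tassoc D D M (tmap \1%VF (lco M) (lco M m)).
Proof. by have /lfunP/(_ m) := lcoA; rewrite !comp_lfunE. Qed.

Lemma lco1E : tcounitl D M (lco M m) = m.
Proof. by have /lfunP/(_ m) := lco1; rewrite !lfun_simp. Qed.

Lemma rcoAE : tmap (rco M) \1%VF (rco M m) =
  tassoc M E E (tmap \1%VF comul (rco M m)).
Proof. by have /lfunP/(_ m) := rcoA; rewrite !comp_lfunE. Qed.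

Lemma rco1E : tcounitr E M (rco M m) = m.
Proof. by have /lfunP/(_ m) := rco1; rewrite !lfun_simp. Qed.

Lemma lrcoE : tmap (lco M) \1%VF (rco M m) =
  tassoc D M E (tmap \1%VF (rco M) (lco M m)).
Proof. by have /lfunP/(_ m) := lrco; rewrite !comp_lfunE. Qed.

End BicomodTheory.

Section Bicomodules.

Variables (k : fieldType) (D E : coalgType k).
Implicit Types M N : bicomod D E.

Definition bicomod_hom M N (phi : 'Hom(M, N)) : Prop :=
  (tmap \1 phi \o lco M = lco N \o phi)%VF /\
  (tmap phi \1 \o rco M = rco N \o phi)%VF.

Definition bicomod_iso M N : Prop :=
  exists phi : 'Hom(M, N), bijective phi /\ bicomod_hom phi.

(* Coactions on a space which embeds by colinear maps as a direct summand of  *)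
(* a power of M satisfy the axioms of bicomodules.                            *)
Section Split.

Variables (M : bicomod D E) (X : vectType k) (I : finType).
Variables (j : I -> 'Hom(X, M)) (lX : 'Hom(X, tens D X)) (rX : 'Hom(X, tens X E)).
Hypothesis jP : jsplit j.
Hypothesis lXj : forall i, (tmap \1 (j i) \o lX = lco M \o j i)%VF.
Hypothesis rXj : forall i, (tmap (j i) \1 \o rX = rco M \o j i)%VF.

Let lXE i x : tmap \1 (j i) (lX x) = lco M (j i x).
Proof. by have /lfunP/(_ x) := lXj i; rewrite !comp_lfunE. Qed.

Let rXE i x : tmap (j i) \1 (rX x) = rco M (j i x).
Proof. by have /lfunP/(_ x) := rXj i; rewrite !comp_lfunE. Qed.

Fact split_is_bicomod : is_bicomod lX rX.
Proof.
split; apply/lfunP=> x; rewrite !comp_lfunE ?id_lfunE.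
- apply: (jsplit_inj (jsplitl (tens D D) jP)) => i.
  rewrite -{2}(tmap_id D D) -tassoc_nat !tmap_compE !comp_lfun1l comp_lfun1r.
  rewrite lXj -(comp_lfun1r comul) -(comp_lfun1l (j i)) -tmap_compE lXE lcoAE.
  by rewrite -lXE tmap_compE !comp_lfun1l.
- apply: (jsplit_inj jP) => i; rewrite -[RHS]lco1E -lXE.
  elim/tens_ind: (lX x) => [d m|u v /= IHu IHv]; last first.
    by rewrite !linearD /= IHu IHv.
  by rewrite tmapE !tcounitlE linearZ id_lfunE.
- apply: (jsplit_inj (jsplitr E (jsplitr E jP))) => i.
  rewrite -tassoc_nat !tmap_compE !comp_lfun1l tmap_id comp_lfun1l comp_lfun1r.
  rewrite rXj -(comp_lfun1r (\1%VF : 'End(E))) -tmap_compE rXE rcoAE.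
  by rewrite -rXE tmap_compE ?comp_lfun1l ?comp_lfun1r.
- apply: (jsplit_inj jP) => i; rewrite -[RHS]rco1E -rXE.
  elim/tens_ind: (rX x) => [m d|u v /= IHu IHv]; last first.
    by rewrite !linearD /= IHu IHv.
  by rewrite tmapE !tcounitrE linearZ id_lfunE.
apply: (jsplit_inj (jsplitr E (jsplitl D jP))) => i.
rewrite -tassoc_nat !tmap_compE !comp_lfun1l lXj rXj.
rewrite -{1}(comp_lfun1r (\1%VF : 'End(E))) -tmap_compE rXE lrcoE -lXE.
by rewrite tmap_compE ?comp_lfun1l ?comp_lfun1r.
Qed.

Definition split_bicomod : bicomod D E :=
  Bicomod split_is_bicomod.

End Split.

(* The coactions of M map P to D (x) P and P (x) E.                           *)
Definition bicomod_stable M (P : {vspace M}) : Prop :=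
  (lco M @: P <= limg (tmap (\1%VF : 'End(D)) (linfun (@vsval _ _ P))))%VS /\
  (rco M @: P <= limg (tmap (linfun (@vsval _ _ P)) (\1%VF : 'End(E))))%VS.

Section Sub.

Variables (M : bicomod D E) (P : {vspace M}) (PM : bicomod_stable P).

Let incl : 'Hom(subvs_of P, M) := linfun vsval.
Let proj : 'Hom(M, subvs_of P) := linfun (vsproj P).

Definition sub_lco : 'Hom(subvs_of P, tens D (subvs_of P)) :=
  (tmap \1 (linfun (vsproj P)) \o lco M \o linfun vsval)%VF.
Definition sub_rco : 'Hom(subvs_of P, tens (subvs_of P) E) :=
  (tmap (linfun (vsproj P)) \1 \o rco M \o linfun vsval)%VF.

Let proj_incl : (proj \o incl = \1)%VF.
Proof. by apply/lfunP=> u; rewrite comp_lfunE !lfunE /= vsvalK. Qed.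

Fact sub_split : jsplit (fun _ : 'I_1 => linfun (@vsval _ _ P)).
Proof. by exists (fun=> proj); rewrite big_ord1 proj_incl. Qed.

Fact sub_lcoE (i : 'I_1) :
  (tmap \1 (linfun vsval) \o sub_lco = lco M \o linfun vsval)%VF.
Proof.
apply/lfunP=> u; rewrite !comp_lfunE.
have /memv_imgP[t _ ->] : lco M (incl u) \in limg (tmap \1 incl).
  by apply: (subvP PM.1); apply: memv_img; rewrite lfunE subvsP.
rewrite !tmap_compE !comp_lfun1l; congr (tmap _ _ t).
by rewrite -[RHS]comp_lfun1r -proj_incl ?comp_lfunA.
Qed.

Fact sub_rcoE (i : 'I_1) :
  (tmap (linfun vsval) \1 \o sub_rco = rco M \o linfun vsval)%VF.
Proof.
apply/lfunP=> u; rewrite !comp_lfunE.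
have /memv_imgP[t _ ->] : rco M (incl u) \in limg (tmap incl \1).
  by apply: (subvP PM.2); apply: memv_img; rewrite lfunE subvsP.
rewrite !tmap_compE !comp_lfun1l; congr (tmap _ _ t).
by rewrite -[RHS]comp_lfun1r -proj_incl ?comp_lfunA.
Qed.

Definition sub_bicomod : bicomod D E :=
  split_bicomod sub_split sub_lcoE sub_rcoE.

End Sub.

Section Pow.

Variables (M : bicomod D E) (n : nat).

Definition pow_pr (i : 'I_n) : 'Hom({ffun 'I_n -> M}, M) :=
  linfun (fun f : {ffun 'I_n -> M} => f i).
Definition pow_inj (i : 'I_n) : 'Hom(M, {ffun 'I_n -> M}) :=
  linfun (fun m : M => [ffun j => if j == i then m else 0]).

Definition pow_lco : 'Hom({ffun 'I_n -> M}, tens D {ffun 'I_n -> M}) :=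
  (\sum_i (tmap \1 (pow_inj i) \o lco M \o pow_pr i)%VF).
Definition pow_rco : 'Hom({ffun 'I_n -> M}, tens {ffun 'I_n -> M} E) :=
  (\sum_i (tmap (pow_inj i) \1 \o rco M \o pow_pr i)%VF).

Lemma pow_prE i f : pow_pr i f = f i.
Proof. by rewrite linfunE // => a x y; rewrite !ffunE. Qed.

Lemma pow_injE i m : pow_inj i m = [ffun j => if j == i then m else 0].
Proof.
rewrite linfunE // => a x y; apply/ffunP=> j; rewrite !ffunE.
by case: eqP; rewrite // scaler0 addr0.
Qed.

Lemma pow_pr_inj i j : (pow_pr i \o pow_inj j)%VF = if i == j then \1%VF else 0.
Proof.
apply/lfunP=> m; rewrite comp_lfunE pow_injE pow_prE ffunE.
by case: eqP; rewrite ?id_lfunE ?zero_lfunE.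
Qed.

Fact pow_split : jsplit pow_pr.
Proof.
exists pow_inj; apply/lfunP=> f; rewrite sum_lfunE id_lfunE; apply/ffunP=> j.
rewrite sum_ffunE (bigD1 j) //= comp_lfunE pow_prE pow_injE ffunE eqxx.
rewrite big1 ?addr0 // => i ij.
by rewrite comp_lfunE pow_prE pow_injE ffunE eq_sym (negbTE ij).
Qed.

Fact pow_lcoE i : (tmap \1 (pow_pr i) \o pow_lco = lco M \o pow_pr i)%VF.
Proof.
apply/lfunP=> f; rewrite !comp_lfunE sum_lfunE linear_sum /= (bigD1 i) //=.
rewrite !comp_lfunE tmap_compE comp_lfun1l pow_pr_inj eqxx tmap_id id_lfunE.
rewrite big1 ?addr0 // => j ij; rewrite !comp_lfunE tmap_compE comp_lfun1l.
by rewrite pow_pr_inj eq_sym (negbTE ij) (bilin0r (tmap_bilin _ _ _ _)) zero_lfunE.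
Qed.

Fact pow_rcoE i : (tmap (pow_pr i) \1 \o pow_rco = rco M \o pow_pr i)%VF.
Proof.
apply/lfunP=> f; rewrite !comp_lfunE sum_lfunE linear_sum /= (bigD1 i) //=.
rewrite !comp_lfunE tmap_compE comp_lfun1l pow_pr_inj eqxx tmap_id id_lfunE.
rewrite big1 ?addr0 // => j ij; rewrite !comp_lfunE tmap_compE comp_lfun1l.
by rewrite pow_pr_inj eq_sym (negbTE ij) (bilin0l (tmap_bilin _ _ _ _)) zero_lfunE.
Qed.

Definition pow_bicomod : bicomod D E :=
  split_bicomod pow_split pow_lcoE pow_rcoE.

End Pow.

Definition bicomod_summand M N : Prop :=
  exists (P Q : {vspace N}) (PN : bicomod_stable P),
    [/\ bicomod_stable Q, (P + Q = fullv)%VS, (P :&: Q = 0)%VS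
      & bicomod_iso M (sub_bicomod PN)].

Definition bicomod_end M : {vspace 'End(M)} :=
  (lker (linfun (fun alpha : 'End(M) =>
     (tmap \1 alpha \o lco M) - (lco M \o alpha))%VF) :&:
   lker (linfun (fun alpha : 'End(M) =>
     (tmap alpha \1 \o rco M) - (rco M \o alpha))%VF))%VS.

Lemma bicomod_endP M (alpha : 'End(M)) :
  alpha \in bicomod_end M <-> bicomod_hom alpha.
Proof.
rewrite memv_cap !memv_ker !linfunE ?subr_eq0.
- by split=> [/andP[/eqP ? /eqP ?]|[-> ->]]; rewrite ?eqxx //; split.
- move=> a x y; rewrite (proj1 (tmap_bilin _ _ _ _)) comp_lfunDl comp_lfunDr.
  by rewrite -comp_lfunZl -comp_lfunZr opprD addrACA scalerBr.
move=> a x y; rewrite (proj2 (tmap_bilin _ _ _ _)) comp_lfunDl comp_lfunDr.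
by rewrite -comp_lfunZl -comp_lfunZr opprD addrACA scalerBr.
Qed.

End Bicomodules.

Section Corestriction.

Variables (k : fieldType) (C D E : coalgType k).
Variables (g : coalgHom C D) (h : coalgHom C E).

Definition corestr_lco : 'Hom(C, tens D C) := (tmap g \1 \o comul)%VF.
Definition corestr_rco : 'Hom(C, tens C E) := (tmap \1 h \o comul)%VF.

(* C as a D-E-bicomodule via c |-> g(c_(1)) (x) c_(2) and                     *)
(* c |-> c_(1) (x) h(c_(2)).                                                  *)
Fact corestr_is_bicomod : is_bicomod corestr_lco corestr_rco.
Proof.
split;
  apply/lfunP=> x; rewrite !comp_lfunE ?id_lfunE.
- rewrite !tmap_compE !comp_lfun1l comp_lfun1r -coalg_comul.
  by rewrite (tmap_splitl comul (tmap g g)) comulAE -tassoc_nat [in RHS](tmap_splitr _ comul).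
- have /lfunP/(_ x) := @counitl k C; rewrite comp_lfunE id_lfunE => {2}<-.
  elim/tens_ind: (comul x) => [d m|u v /= IHu IHv]; last first.
    by rewrite !linearD /= IHu IHv.
  by rewrite tmapE !tcounitlE id_lfunE -comp_lfunE coalg_counit.
- rewrite !tmap_compE !comp_lfun1l comp_lfun1r -coalg_comul.
  by rewrite (tmap_splitl comul (tmap \1%VF h)) comulAE -tassoc_nat [in RHS](tmap_splitr _ comul (tmap h h)).
- have /lfunP/(_ x) := @counitr k C; rewrite comp_lfunE id_lfunE => {2}<-.
  elim/tens_ind: (comul x) => [d m|u v /= IHu IHv]; last first.
    by rewrite !linearD /= IHu IHv.
  by rewrite tmapE !tcounitrE id_lfunE -comp_lfunE coalg_counit.
rewrite !tmap_compE !comp_lfun1l comp_lfun1r.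
by rewrite comp_lfun1r (tmap_splitl comul (tmap g \1%VF)) comulAE -tassoc_nat [in RHS](tmap_splitr _ comul (tmap \1%VF h)).
Qed.

Definition corestr : bicomod D E :=
  Bicomod corestr_is_bicomod.

End Corestriction.
Section TensorKernel.

Variable k : fieldType.
Implicit Types U V W X : vectType k.

Lemma tmapBl U V W X (f f' : 'Hom(U, V)) (g : 'Hom(W, X)) :
  tmap (f - f') g = tmap f g - tmap f' g.
Proof.
rewrite (bilinDl (tmap_bilin _ _ _ _)) -!scaleN1r.
by rewrite (bilinZl (tmap_bilin _ _ _ _)).
Qed.

Lemma tmapBr U V W X (f f' : 'Hom(U, V)) (g : 'Hom(W, X)) :
  tmap g (f - f') = tmap g f - tmap g f'.
Proof.
rewrite (bilinDr (tmap_bilin _ _ _ _)) -!scaleN1r.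
by rewrite (bilinZr (tmap_bilin _ _ _ _)).
Qed.

Lemma lker_split V W (H : 'Hom(V, W)) :
  (linfun (@vsval _ _ (lker H)) \o (linfun (vsproj (lker H)) \o
    (\1 - (H^-1 \o H))) = \1 - (H^-1 \o H))%VF.
Proof.
apply/lfunP=> v; rewrite comp_lfunE lfunE /= comp_lfunE lfunE /= vsprojK //.
rewrite memv_ker !lfun_simp linearB /= subr_eq0.
by rewrite limg_lfunVK // memv_img ?memvf.
Qed.

Lemma tens_lkerl U V W (H : 'Hom(V, W)) (x : tens U V) :
  tmap \1 H x = 0 ->
  x \in limg (tmap (\1%VF : 'End(U)) (linfun (@vsval _ _ (lker H)))).
Proof.
move=> Hx; apply/memv_imgP; exists (tmap \1 (linfun (vsproj (lker H)) \o
    (\1 - (H^-1 \o H))) x)%VF; first exact: memvf.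
rewrite tmap_compE comp_lfun1l lker_split tmapBr add_lfunE opp_lfunE.
rewrite (tmap_splitr _ H) Hx linear0 subr0.
by rewrite tmap_id id_lfunE.
Qed.

Lemma tens_lkerr U V W (H : 'Hom(V, W)) (x : tens V U) :
  tmap H \1 x = 0 ->
  x \in limg (tmap (linfun (@vsval _ _ (lker H))) (\1%VF : 'End(U))).
Proof.
move=> Hx; apply/memv_imgP; exists (tmap (linfun (vsproj (lker H)) \o
    (\1 - (H^-1 \o H))) \1 x)%VF; first exact: memvf.
rewrite tmap_compE comp_lfun1l lker_split tmapBl add_lfunE opp_lfunE.
rewrite (tmap_splitl H) Hx linear0 subr0.
by rewrite tmap_id id_lfunE.
Qed.

End TensorKernel.

Section Cotensor.

Variables (k : fieldType) (D' E' : coalgType k).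

Section TensBicomod.

Variables (X Y : coalgType k) (M : bicomod D' X) (N : bicomod Y E').

Definition tens_lco : 'Hom(tens M N, tens D' (tens M N)) :=
  (tassocV D' M N \o tmap (lco M) \1)%VF.
Definition tens_rco : 'Hom(tens M N, tens (tens M N) E') :=
  (tassoc M N E' \o tmap \1 (rco N))%VF.

Fact tens_is_bicomod : is_bicomod tens_lco tens_rco.
Proof.
split;
  apply/lfunP=> x; rewrite !comp_lfunE ?id_lfunE.
- rewrite -{1}(tmap_id M N) -tassocV_nat tmap_compE comp_lfun1l lcoA.
  rewrite (tmap_splitr _ (tmap (lco M) \1%VF)).
  rewrite [in LHS](tmap_splitl _ (tassoc D' D' M \o tmap \1 (lco M))%VF).
  rewrite [in LHS](tmap_splitl _ (tassoc D' D' M)).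
  by rewrite -[X in _ = _ (_ X)]tassocV_nat -pentagonV.
- elim/tens_ind: x => [m n|u v /= IHu IHv]; last first.
    by rewrite !linearD /= IHu IHv.
  rewrite tmapE id_lfunE -{2}[m]lco1E.
  elim/tens_ind: (lco M m) => [d p|u v /= IHu IHv]; last first.
    by rewrite (bilinDl (tmul_bilin _ _)) !linearD /=
               (bilinDl (tmul_bilin _ _)) IHu IHv.
  by rewrite tassocVE !tcounitlE (bilinZl (tmul_bilin _ _)).
- rewrite (tmap_splitl (tmap \1%VF (rco N)) (tassoc M N E')).
  rewrite -[X in tmap _ _ X = _]tassoc_nat tmap_compE comp_lfun1l rcoA.
  rewrite [in LHS](tmap_splitr _ (rco N) (tassoc N E' E' \o tmap \1 comul)%VF).
  rewrite [in LHS](tmap_splitr _ (tmap \1%VF comul) (tassoc N E' E')).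
  by rewrite pentagon -[in RHS](tmap_id M N) -[in RHS]tassoc_nat.
- elim/tens_ind: x => [m n|u v /= IHu IHv]; last first.
    by rewrite !linearD /= IHu IHv.
  rewrite tmapE id_lfunE -{2}[n]rco1E.
  elim/tens_ind: (rco N n) => [p d|u v /= IHu IHv]; last first.
    by rewrite (bilinDr (tmul_bilin _ _)) !linearD /=
               (bilinDr (tmul_bilin _ _)) IHu IHv.
  by rewrite tassocE !tcounitrE (bilinZr (tmul_bilin _ _)).
rewrite [in LHS](tmap_splitl (tmap (lco M) \1%VF) (tassocV D' M N)).
rewrite [in RHS](tmap_splitr _ (tmap \1%VF (rco N)) (tassoc M N E')).
rewrite -[X in tmap _ _ X = _]tassoc_nat -[X in _ = _ (_ X)]tassocV_nat.
rewrite -pentagonM (tmap_id N E') (tmap_id D' M).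
by rewrite (tmap_compE (lco M)) (tmap_compE \1%VF) !comp_lfun1l !comp_lfun1r.
Qed.

Definition tens_bicomod : bicomod D' E' :=
  Bicomod tens_is_bicomod.

End TensBicomod.

Section Cotens.

Variables (D : coalgType k) (M : bicomod D' D) (N : bicomod D E').

(* M []_D N is the equalizer of the two maps M (x) N -> (M (x) D) (x) N.      *)
Definition cotens_map : 'Hom(tens M N, tens (tens M D) N) :=
  (tmap (rco M) \1 - (tassoc M D N \o tmap \1 (lco N)))%VF.

Definition cotens : {vspace tens M N} := lker cotens_map.

Lemma cotensP x : reflect
  (tmap (rco M) \1 x = tassoc M D N (tmap \1 (lco N) x)) (x \in cotens).
Proof.
by rewrite memv_ker !lfun_simp subr_eq0; apply: eqP.
Qed.

Lemma cotens_stable : @bicomod_stable _ _ _ (tens_bicomod M N) cotens.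
Proof.
split; apply/subvP=> _ /memv_imgP[x /cotensP xP ->].
  apply: tens_lkerl; rewrite /= tmapBr add_lfunE opp_lfunE.
  apply/eqP; rewrite subr_eq0 !comp_lfunE; apply/eqP.
  rewrite -tassocV_nat tmap_compE comp_lfun1l.
  transitivity (tassocV D' (tens M D) N (tmap
    (tassocV D' M D \o tmap (lco M) \1)%VF \1%VF (tmap (rco M) \1%VF x))).
    rewrite -tmap_splitl; congr (tassocV _ _ _ (tmap _ _ x)).
    apply/lfunP=> m; rewrite !comp_lfunE lrcoE; exact/esym/tassocK.
  rewrite xP (tmap_splitl (tmap (lco M) \1%VF)) -tassoc_nat tmap_id tmap_compE.
  rewrite comp_lfun1l comp_lfun1r -pentagonM tassocK.
  rewrite [in RHS](tmap_splitr _ (tmap \1%VF (lco N)) (tassoc M D N)).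
  congr (tmap _ _ _); rewrite -tassocV_nat tmap_id tmap_compE.
  by rewrite comp_lfun1l comp_lfun1r.
apply: tens_lkerr; rewrite /= tmapBl add_lfunE opp_lfunE.
apply/eqP; rewrite subr_eq0 !comp_lfunE; apply/eqP.
rewrite -tassoc_nat tmap_id tmap_compE comp_lfun1l comp_lfun1r.
transitivity (tassoc (tens M D) N E' (tmap \1%VF (rco N) (tmap (rco M) \1%VF x))).
  by rewrite tmap_compE comp_lfun1l comp_lfun1r.
rewrite xP -{1}(tmap_id M D) -tassoc_nat tmap_compE comp_lfun1l.
rewrite [in RHS](tmap_splitl (tmap \1%VF (lco N)) (tassoc M D N)).
rewrite -[X in _ = tmap _ _ X]tassoc_nat tmap_compE comp_lfun1l lrco -comp_lfunA.
by rewrite [in RHS](tmap_splitr _ _ (tassoc D N E')) pentagon.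
Qed.

Definition cotens_bicomod : bicomod D' E' := sub_bicomod cotens_stable.

End Cotens.

End Cotensor.

Section Restriction.

Variables (k : fieldType) (B A E : fdAlgType k).
Variables (f : algHom B A) (h : algHom E A).

Definition restr_lact (b : B) (a : A) : A := f b ** a.
Definition restr_ract (a : A) (e : E) : A := a ** h e.

Fact restr_is_bimod : is_bimod restr_lact restr_ract.
Proof.
have mb := amul_bilin (s := A).
split.
- by apply: bilinP => [a x y z|a z x y];
    rewrite /restr_lact ?linearP ?(proj1 mb) ?(proj2 mb).
- by apply: bilinP => [a x y z|a z x y];
    rewrite /restr_ract ?linearP ?(proj1 mb) ?(proj2 mb).
- by move=> b b' m; rewrite /restr_lact alg_funM amulA.
- by move=> m; rewrite /restr_lact alg_fun1 amul1l.
- by move=> m a a'; rewrite /restr_ract alg_funM amulA.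
- by move=> m; rewrite /restr_ract alg_fun1 amul1r.
by move=> b m a; rewrite /restr_ract /restr_lact amulA.
Qed.

Definition restr : bimod B E := Bimod restr_is_bimod.

End Restriction.

Section TensorBimodule.

Variables (k : fieldType) (B' A' : fdAlgType k).

Section TensBimod.

Variables (X Y : fdAlgType k) (M : bimod B' X) (N : bimod Y A').

Definition tens_lact (b : B') (t : tens M N) : tens M N :=
  tmap (linfun (@lact _ _ _ M b)) \1 t.
Definition tens_ract (t : tens M N) (a : A') : tens M N :=
  tmap \1 (linfun (fun n : N => ract n a)) t.

Lemma tens_lactE b m n : tens_lact b (m \ox n) = lact b m \ox n.
Proof.
by rewrite /tens_lact tmapE id_lfunE linfunE //; apply: (proj2 (lact_bilin _)).
Qed.

Lemma tens_ractE a m n : tens_ract (m \ox n) a = m \ox ract n a.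
Proof.
by rewrite /tens_ract tmapE id_lfunE linfunE //; apply: (proj1 (ract_bilin _)).
Qed.

Fact tens_lact_bilin : bilin tens_lact.
Proof.
apply: bilinP => [a b b' t|a b t t']; last exact: linearP.
elim/tens_ind: t => [m n|x y IHx IHy].
  by rewrite !tens_lactE (proj1 (lact_bilin _)) (proj1 (tmul_bilin _ _)).
rewrite {1}/tens_lact linearD /= -!/(tens_lact _ _) IHx IHy addrACA -scalerDr.
by rewrite /tens_lact !linearD.
Qed.

Fact tens_ract_bilin : bilin tens_ract.
Proof.
apply: bilinP => [a t t' b|a t b b']; first exact: linearP.
elim/tens_ind: t => [m n|x y IHx IHy].
  by rewrite !tens_ractE (proj2 (ract_bilin _)) (proj2 (tmul_bilin _ _)).
rewrite {1}/tens_ract linearD /= -!/(tens_ract _ _) IHx IHy addrACA -scalerDr.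
by rewrite /tens_ract !linearD.
Qed.

Fact tens_is_bimod : is_bimod tens_lact tens_ract.
Proof.
have [lD rD] := (bilinDr tens_lact_bilin, bilinDl tens_ract_bilin).
apply: (IsBimod tens_lact_bilin tens_ract_bilin).
- move=> b b' t; elim/tens_ind: t => [m n|x y IHx IHy].
    by rewrite !tens_lactE lactA.
  by rewrite !lD IHx IHy.
- move=> t; elim/tens_ind: t => [m n|x y IHx IHy].
    by rewrite !tens_lactE lact1.
  by rewrite !lD IHx IHy.
- move=> t b b'; elim/tens_ind: t => [m n|x y IHx IHy].
    by rewrite !tens_ractE ractA.
  by rewrite !rD IHx IHy.
- move=> t; elim/tens_ind: t => [m n|x y IHx IHy].
    by rewrite !tens_ractE ract1.
  by rewrite !rD IHx IHy.
move=> b t a; elim/tens_ind: t => [m n|x y IHx IHy].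
  by rewrite tens_ractE !tens_lactE tens_ractE.
by rewrite !(lD, rD) IHx IHy.
Qed.

Definition tens_bimod : bimod B' A' := Bimod tens_is_bimod.

End TensBimod.

Variables (B : fdAlgType k) (M : bimod B' B) (N : bimod B A').

Definition bal_rel : {vspace tens M N} :=
  limg (bal_map (@ract _ _ _ M) (@lact _ _ _ N)).

Fact bal_rel_stable : @bimod_stable _ _ _ (tens_bimod M N) bal_rel.
Proof.
have [lD rD] := (bilinDr (tens_lact_bilin M N), bilinDl (tens_ract_bilin M N)).
have tl := bilinDl (tmul_bilin (tens M B) N).
pose bm := bal_mapE (ract_bilin M) (lact_bilin N).
split=> [b m0 /memv_imgP[t _ ->]|m0 a /memv_imgP[t _ ->]] /=.
  elim/tens_ind: t => [s n|x y IHx IHy]; last first.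
    by rewrite linearD /= lD memvD.
  elim/tens_ind: s => [m l|x y IHx IHy]; last first.
    by rewrite tl linearD /= lD memvD.
  have -> : tens_lact b (bal_map (@ract _ _ _ M) (@lact _ _ _ N)
      (m \ox l \ox n)) = bal_map (@ract _ _ _ M) (@lact _ _ _ N)
      (lact b m \ox l \ox n).
    by rewrite !bm {1}/tens_lact linearB /= -!/(tens_lact _ _) !tens_lactE lractA.
  exact: memv_img (memvf _).
elim/tens_ind: t => [s n|x y IHx IHy]; last first.
  by rewrite linearD /= rD memvD.
elim/tens_ind: s => [m l|x y IHx IHy]; last first.
  by rewrite tl linearD /= rD memvD.
have -> : tens_ract (bal_map (@ract _ _ _ M) (@lact _ _ _ N)
    (m \ox l \ox n)) a = bal_map (@ract _ _ _ M) (@lact _ _ _ N)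
    (m \ox l \ox ract n a).
  by rewrite !bm {1}/tens_ract linearB /= -!/(tens_ract _ _) !tens_ractE lractA.
exact: memv_img (memvf _).
Qed.

Definition rtens_bimod : bimod B' A' := quo_bimod bal_rel_stable.

End TensorBimodule.

Section DepthTwo.

Variables (k : fieldType) (B A : fdAlgType k) (f : algHom B A).

Definition left_depth_two : Prop :=
  exists2 n : nat, (0 < n)%N &
    bimod_summand (rtens_bimod (restr f f) (restr f (alg_id A)))
                  (pow_bimod (restr f (alg_id A)) n).

Definition right_depth_two : Prop :=
  exists2 n : nat, (0 < n)%N &
    bimod_summand (rtens_bimod (restr (alg_id A) f) (restr f f))
                  (pow_bimod (restr (alg_id A) f) n).

End DepthTwo.

Section CodepthTwo.

Variables (k : fieldType) (C D : coalgType k) (g : coalgHom C D).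

Definition left_codepth_two : Prop :=
  exists2 n : nat, (0 < n)%N &
    bicomod_summand (cotens_bicomod (corestr g g) (corestr g (coalg_id C)))
                    (pow_bicomod (corestr g (coalg_id C)) n).

Definition right_codepth_two : Prop :=
  exists2 n : nat, (0 < n)%N &
    bicomod_summand (cotens_bicomod (corestr (coalg_id C) g) (corestr g g))
                    (pow_bicomod (corestr (coalg_id C) g) n).

End CodepthTwo.

Section Centralizer.

Variables (k : fieldType) (B A : fdAlgType k) (f : algHom B A).

Definition centralizer : {vspace A} :=
  lker (linfun (fun r : A => linfun (fun b : B => f b ** r - r ** f b))).

Lemma centralizerP r :
  r \in centralizer <-> forall b, f b ** r = r ** f b.
Proof.
have mb := amul_bilin (s := A).
have iL s : linear (fun b : B => f b ** s - s ** f b).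
  move=> a x y; rewrite linearP (proj1 mb) (proj2 mb) opprD addrACA.
  by rewrite scalerBr.
have oL : linear (fun r : A => linfun (fun b : B => f b ** r - r ** f b)).
  move=> a x y; apply/lfunP=> b; rewrite !lfun_simp !(linfunE (iL _)).
  by rewrite (proj1 mb) (proj2 mb) opprD addrACA scalerBr.
rewrite memv_ker (linfunE oL).
split=> [/eqP/lfunP r0 b|rb].
  by apply/eqP; rewrite -subr_eq0 -(linfunE (iL r)) r0 zero_lfunE.
by apply/eqP/lfunP=> b; rewrite (linfunE (iL r)) rb subrr zero_lfunE.
Qed.

End Centralizer.

(* lend is the left R-bialgebroid S = End(_B A_B), with R = centralizer f.    *)
Section LeftBialgebroid.

Variables (k : fieldType) (B A : fdAlgType k) (f : algHom B A).

Definition lend : Type := subvs_of (bimod_end (restr f f)).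
HB.instance Definition _ := Vector.on lend.

Definition lend_fun (alpha : lend) : 'End(A) := vsval alpha.
Local Coercion lend_fun : lend >-> hom.

Lemma lendP (alpha : lend) :
  (forall b x, alpha (f b ** x) = f b ** alpha x) /\
  (forall x b, alpha (x ** f b) = alpha x ** f b).
Proof. by have /bimod_endP := subvsP alpha. Qed.

Fact lend_mem (alpha : 'End(A)) :
  (forall b x, alpha (f b ** x) = f b ** alpha x) ->
  (forall x b, alpha (x ** f b) = alpha x ** f b) ->
  (alpha : 'End(restr f f)) \in bimod_end (restr f f).
Proof. by move=> al ar; apply/(@bimod_endP _ _ _ (restr f f)); split. Qed.

Fact lend_mul_mem (alpha beta : lend) :
  (alpha \o beta : 'End(restr f f))%VF \in bimod_end (restr f f).
Proof.
by apply: lend_mem => [b x|x b]; rewrite !comp_lfunE;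
  [rewrite (lendP beta).1 (lendP alpha).1|rewrite (lendP beta).2 (lendP alpha).2].
Qed.

Definition lend_mul (alpha beta : lend) : lend :=
  Subvs (lend_mul_mem alpha beta).

Fact lend_one_mem : (\1%VF : 'End(restr f f)) \in bimod_end (restr f f).
Proof. by apply: lend_mem => [b x|x b]; rewrite !id_lfunE. Qed.

Definition lend_one : lend := Subvs lend_one_mem.

Definition lmul (a : A) : 'End(A) := linfun (amul a).
Definition rmul (a : A) : 'End(A) := linfun (fun x => x ** a).

Lemma lmulE a x : lmul a x = a ** x.
Proof. exact: (linfunE (proj2 (amul_bilin (s := A)) a)). Qed.

Lemma rmulE a x : rmul a x = x ** a.
Proof. exact: (linfunE (proj1 (amul_bilin (s := A)) a)). Qed.

Local Notation R := (subvs_of (centralizer f)).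

Lemma centP (r : R) b : f b ** vsval r = vsval r ** f b.
Proof. by have /centralizerP := subvsP r; apply. Qed.

Fact lend_src_mem (r : R) :
  (lmul (vsval r) : 'End(restr f f)) \in bimod_end (restr f f).
Proof.
by apply: lend_mem => [b x|x b]; rewrite !lmulE ?amulA ?centP.
Qed.

Fact lend_tgt_mem (r : R) :
  (rmul (vsval r) : 'End(restr f f)) \in bimod_end (restr f f).
Proof.
by apply: lend_mem => [b x|x b]; rewrite !rmulE -?amulA ?centP.
Qed.

Definition lend_src (r : R) : lend := Subvs (lend_src_mem r).
Definition lend_tgt (r : R) : lend := Subvs (lend_tgt_mem r).

(* r . alpha . s = r alpha(-) s *)
Definition lend_lact (r : R) (alpha : lend) : lend :=
  lend_mul (lend_src r) alpha.
Definition lend_ract (alpha : lend) (s : R) : lend :=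
  lend_mul (lend_tgt s) alpha.

Fact lend_counit_mem (alpha : lend) : alpha aone \in centralizer f.
Proof.
by apply/centralizerP => b; rewrite -(lendP alpha).1 -(lendP alpha).2 amul1l amul1r.
Qed.

Definition lend_counit (alpha : lend) : R := Subvs (lend_counit_mem alpha).

Definition lend2 : Type := rtens lend_ract lend_lact.
HB.instance Definition _ := Vector.on lend2.

(* The map x, y |-> alpha_(1)(x) alpha_(2)(y), for t = alpha_(1) (x) alpha_(2). *)
Definition lend2_eval (t : lend2) (x y : A) : A :=
  rlift lend_ract lend_lact (fun alpha beta : lend => alpha x ** beta y) t.

Definition is_lend_comul (Delta : 'Hom(lend, lend2)) : Prop :=
  forall (alpha : lend) (t : lend2),
    t = Delta alpha <-> forall x y, lend2_eval t x y = alpha (x ** y).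

Lemma lend_lact_bilin : bilin lend_lact.
Proof.
have mb := amul_bilin (s := A).
apply: bilinP => [a x y z|a z x y]; apply/val_inj/lfunP => u.
  by rewrite /= !lfun_simp !lmulE ?linearP (proj1 mb).
by rewrite /= !lfun_simp !lmulE (proj2 mb).
Qed.

Lemma lend_ract_bilin : bilin lend_ract.
Proof.
have mb := amul_bilin (s := A).
apply: bilinP => [a x y z|a z x y]; apply/val_inj/lfunP => u.
  by rewrite /= !lfun_simp !rmulE (proj1 mb).
by rewrite /= !lfun_simp !rmulE ?linearP (proj2 mb).
Qed.

Lemma lend2_evalE (alpha beta : lend) x y :
  lend2_eval (rtmul lend_ract lend_lact alpha beta) x y = alpha x ** beta y.
Proof.
have mb := amul_bilin (s := A).
rewrite /lend2_eval rliftE //; last 1 first.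
- by move=> m l n; rewrite /= /lend_fun /= !comp_lfunE rmulE lmulE amulA.
- exact: lend_ract_bilin.
- exact: lend_lact_bilin.
by apply: bilinP => [a u v z|a z u v]; rewrite /lend_fun /= !lfun_simp
  ?(proj1 mb) ?(proj2 mb).
Qed.

End LeftBialgebroid.

(* rend is the right R-bialgebroid End(^D C^D), with R the centralizer of the *)
(* image of D^* in C^*.                                                       *)
Section RightBialgebroid.

Variables (k : fieldType) (C D : coalgType k) (g : coalgHom C D).

Definition rend : Type := subvs_of (bicomod_end (corestr g g)).
HB.instance Definition _ := Vector.on rend.

Definition rend_fun (alpha : rend) : 'End(C) := vsval alpha.
Local Coercion rend_fun : rend >-> hom.

Local Notation lcoC := (corestr_lco g).
Local Notation rcoC := (corestr_rco g).

Lemma lcoCE c : lcoC c = tmap g \1 (comul c).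
Proof. exact: comp_lfunE. Qed.

Lemma rcoCE c : rcoC c = tmap \1 g (comul c).
Proof. exact: comp_lfunE. Qed.

Lemma rendP (alpha : rend) :
  (tmap \1 alpha \o lcoC = lcoC \o alpha)%VF /\
  (tmap alpha \1 \o rcoC = rcoC \o alpha)%VF.
Proof. by have /bicomod_endP := subvsP alpha. Qed.

Lemma rendlE (alpha : rend) c : tmap \1 alpha (lcoC c) = lcoC (alpha c).
Proof. by have /lfunP/(_ c) := (rendP alpha).1; rewrite comp_lfunE => ->; rewrite comp_lfunE. Qed.

Lemma rendrE (alpha : rend) c : tmap alpha \1 (rcoC c) = rcoC (alpha c).
Proof. by have /lfunP/(_ c) := (rendP alpha).2; rewrite comp_lfunE => ->; rewrite comp_lfunE. Qed.

Fact rend_mem (alpha : 'End(C)) :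
  (forall c, tmap \1 alpha (lcoC c) = lcoC (alpha c)) ->
  (forall c, tmap alpha \1 (rcoC c) = rcoC (alpha c)) ->
  (alpha : 'End(corestr g g)) \in bicomod_end (corestr g g).
Proof.
move=> al ar; apply/(@bicomod_endP _ _ _ (corestr g g)).
by split; apply/lfunP => c; rewrite comp_lfunE [in RHS]comp_lfunE ?al ?ar.
Qed.

Fact rend_mul_mem (alpha beta : rend) :
  (alpha \o beta : 'End(corestr g g))%VF \in bicomod_end (corestr g g).
Proof.
apply: rend_mem => c; rewrite [in RHS]comp_lfunE.
  by rewrite (tmap_splitr _ beta alpha) !rendlE.
by rewrite (tmap_splitl beta alpha) !rendrE.
Qed.

Definition rend_mul (alpha beta : rend) : rend :=
  Subvs (rend_mul_mem alpha beta).

Fact rend_one_mem : (\1%VF : 'End(corestr g g)) \in bicomod_end (corestr g g).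
Proof. by apply: rend_mem => c; rewrite tmap_id !id_lfunE. Qed.

Definition rend_one : rend := Subvs rend_one_mem.

(* c |-> c_(1) phi(c_(2)) and c |-> phi(c_(1)) c_(2) *)
Definition rhit (phi : dual C) : 'End(C) :=
  (tlift (fun a b => (phi b : k) *: a) \o comul)%VF.
Definition lhit (phi : dual C) : 'End(C) :=
  (tlift (fun a b => (phi a : k) *: b) \o comul)%VF.

Lemma rhit_bilin (phi : dual C) (M : vectType k) :
  bilin (fun (a : M) (b : C) => (phi b : k) *: a).
Proof.
apply: bilinP => [a x y z|a z x y].
  by rewrite scalerDr !scalerA mulrC.
by rewrite linearP /= scalerDl scalerA.
Qed.

Lemma lhit_bilin (phi : dual C) (M : vectType k) :
  bilin (fun (a : C) (b : M) => (phi a : k) *: b).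
Proof.
apply: bilinP => [a x y z|a z x y].
  by rewrite linearP /= scalerDl scalerA.
by rewrite scalerDr !scalerA mulrC.
Qed.

(* phi((rhit eta)(c)) = (phi * eta)(c), phi((lhit eta)(c)) = (eta * phi)(c) *)
Lemma dual_rhit (phi eta : dual C) c : phi (rhit eta c) = (phi ** eta) c.
Proof.
rewrite !comp_lfunE; elim/tens_ind: (comul c) => [a b|x y /= IHx IHy].
  rewrite (tliftE _ _ (rhit_bilin _ _)) (tliftE _ _ (conv_lift_bilin _ _)).
  by rewrite linearZ /= mulrC.
by rewrite !linearD /= IHx IHy.
Qed.

Lemma dual_lhit (phi eta : dual C) c : phi (lhit eta c) = (eta ** phi) c.
Proof.
rewrite !comp_lfunE; elim/tens_ind: (comul c) => [a b|x y /= IHx IHy].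
  rewrite (tliftE _ _ (lhit_bilin _ _)) (tliftE _ _ (conv_lift_bilin _ _)).
  by rewrite linearZ.
by rewrite !linearD /= IHx IHy.
Qed.

Lemma rhit_comul (phi : dual C) c :
  tmap \1 (rhit phi) (comul c) = comul (rhit phi c).
Proof.
transitivity (tlift (fun (t : tens C C) b => (phi b : k) *: t)
  (tmap comul \1%VF (comul c))).
  rewrite comulAE (tmap_splitr _ comul).
  elim/tens_ind: (tmap \1%VF comul _) => [x t|x y /= IHx IHy]; last first.
    by rewrite !linearD /= IHx IHy.
  rewrite tmapE id_lfunE; elim/tens_ind: t => [y z|u v /= IHu IHv]; last first.
    by rewrite !linearD /= !(bilinDr (tmul_bilin _ _)) !linearD /= IHu IHv.
  rewrite tassocE !(tliftE _ _ (rhit_bilin _ _)).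
  by rewrite (bilinZr (tmul_bilin _ _)).
rewrite [in RHS]comp_lfunE.
elim/tens_ind: (comul c) => [x y|x y /= IHx IHy]; last first.
  by rewrite !linearD /= IHx IHy.
by rewrite tmapE id_lfunE !(tliftE _ _ (rhit_bilin _ _)) linearZ.
Qed.

Lemma lhit_comul (phi : dual C) c :
  tmap (lhit phi) \1 (comul c) = comul (lhit phi c).
Proof.
transitivity (tlift (fun a (t : tens C C) => (phi a : k) *: t)
  (tmap \1%VF comul (comul c))).
  rewrite (tmap_splitl comul) comulAE.
  elim/tens_ind: (tmap \1%VF comul _) => [x t|x y /= IHx IHy]; last first.
    by rewrite !linearD /= IHx IHy.
  elim/tens_ind: t => [y z|u v /= IHu IHv]; last first.
    by rewrite !(bilinDr (tmul_bilin _ _)) !linearD /= IHu IHv.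
  rewrite tassocE tmapE id_lfunE !(tliftE _ _ (lhit_bilin _ _)).
  by rewrite (bilinZl (tmul_bilin _ _)).
rewrite [in RHS]comp_lfunE.
elim/tens_ind: (comul c) => [x y|x y /= IHx IHy]; last first.
  by rewrite !linearD /= IHx IHy.
by rewrite tmapE id_lfunE !(tliftE _ _ (lhit_bilin _ _)) linearZ.
Qed.

Lemma rhit_lhit_comul (phi : dual C) c :
  tmap (rhit phi) \1 (comul c) = tmap \1 (lhit phi) (comul c).
Proof.
rewrite (tmap_splitl comul) comulAE (tmap_splitr _ comul).
elim/tens_ind: (tmap \1%VF comul _) => [x t|x y /= IHx IHy]; last first.
  by rewrite !linearD /= IHx IHy.
elim/tens_ind: t => [y z|u v /= IHu IHv]; last first.
  by rewrite !(bilinDr (tmul_bilin _ _)) !linearD /= IHu IHv.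
rewrite tassocE !tmapE !id_lfunE (tliftE _ _ (lhit_bilin _ _)).
rewrite (tliftE _ _ (rhit_bilin _ _)).
by rewrite (bilinZl (tmul_bilin _ _)) (bilinZr (tmul_bilin _ _)).
Qed.

Lemma dual_separates (V : vectType k) (x y : V) :
  (forall b : 'Hom(V, k^o), b x = b y) -> x = y.
Proof.
move=> bxy; rewrite (coord_vbasis (memvf x)) (coord_vbasis (memvf y)).
apply: eq_bigr => i _; congr (_ *: _).
pose b : 'Hom(V, k^o) := linfun (coord (vbasis {:V}) i : V -> k^o).
by have := bxy b; rewrite !lfunE.
Qed.

Local Notation R := (subvs_of (centralizer (dual_hom g))).

Lemma cent_hit (r : R) c : g (lhit (vsval r) c) = g (rhit (vsval r) c).
Proof.
apply: dual_separates => b; have /lfunP/(_ c) := centP r b.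
rewrite [dual_hom g b]dual_mapE => rb.
have := dual_lhit (b \o g)%VF (vsval r) c; rewrite comp_lfunE => ->.
by rewrite -rb -dual_rhit comp_lfunE.
Qed.

(* s_R(r)(c) = c_(1) r(c_(2)) and t_R(r)(c) = r(c_(1)) c_(2) *)
Fact rend_src_mem (r : R) :
  (rhit (vsval r) : 'End(corestr g g)) \in bicomod_end (corestr g g).
Proof.
apply: rend_mem => c; rewrite !(lcoCE, rcoCE) -rhit_comul.
  by rewrite !tmap_compE !comp_lfun1l !comp_lfun1r.
transitivity (tmap \1%VF g (tmap (rhit (vsval r)) \1%VF (comul c))).
  by rewrite !tmap_compE !comp_lfun1l !comp_lfun1r.
rewrite rhit_lhit_comul !tmap_compE; congr (tmap _ _ _).
by apply/lfunP=> x; rewrite comp_lfunE [in RHS]comp_lfunE cent_hit.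
Qed.

Fact rend_tgt_mem (r : R) :
  (lhit (vsval r) : 'End(corestr g g)) \in bicomod_end (corestr g g).
Proof.
apply: rend_mem => c; rewrite !(lcoCE, rcoCE) -lhit_comul.
  transitivity (tmap g \1%VF (tmap \1%VF (lhit (vsval r)) (comul c))).
    by rewrite !tmap_compE !comp_lfun1l !comp_lfun1r.
  rewrite -rhit_lhit_comul !tmap_compE; congr (tmap _ _ _).
  by apply/lfunP=> x; rewrite comp_lfunE [in RHS]comp_lfunE cent_hit.
by rewrite !tmap_compE !comp_lfun1l !comp_lfun1r.
Qed.

Definition rend_src (r : R) : rend := Subvs (rend_src_mem r).
Definition rend_tgt (r : R) : rend := Subvs (rend_tgt_mem r).

(* r . alpha . s = alpha \o s_R(s) \o t_R(r) *)
Definition rend_lact (r : R) (alpha : rend) : rend :=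
  rend_mul alpha (rend_tgt r).
Definition rend_ract (alpha : rend) (s : R) : rend :=
  rend_mul alpha (rend_src s).

Lemma conv_comp (V W : vectType k) (u : 'Hom(C, V)) (v : 'Hom(C, W))
    (x : 'Hom(V, k^o)) (y : 'Hom(W, k^o)) c :
  ((x \o u : dual C)%VF ** (y \o v : dual C)%VF) c =
  tlift (fun a b => x a * y b : k^o) (tmap u v (comul c)).
Proof.
rewrite comp_lfunE; elim/tens_ind: (comul c) => [a b|p q /= IHp IHq].
  rewrite tmapE (tliftE _ _ (conv_lift_bilin _ _)) tliftE ?comp_lfunE //.
  apply: bilinP => [e p q r|e r p q]; rewrite linearP /=.
    by rewrite mulrDl -mulrA.
  by rewrite mulrDr mulrCA.
by rewrite !linearD /= IHp IHq.
Qed.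

Fact rend_counit_mem (alpha : rend) :
  (counit \o alpha : dual C)%VF \in centralizer (dual_hom g).
Proof.
apply/centralizerP => b; rewrite [dual_hom g b]dual_mapE; apply/lfunP => c.
rewrite !conv_comp.
have <- : tmap \1%VF alpha (lcoC c) = tmap g alpha (comul c).
  by rewrite lcoCE tmap_compE comp_lfun1l comp_lfun1r.
have <- : tmap alpha \1%VF (rcoC c) = tmap alpha g (comul c).
  by rewrite rcoCE tmap_compE comp_lfun1l comp_lfun1r.
rewrite rendlE rendrE lcoCE rcoCE -!conv_comp !comp_lfun1r.
by rewrite [RHS](_ : _ = (aone ** (b \o g : dual C)%VF) (alpha c)) //
  [LHS](_ : _ = ((b \o g : dual C)%VF ** aone) (alpha c)) // amul1l amul1r.
Qed.

Definition rend_counit (alpha : rend) : R := Subvs (rend_counit_mem alpha).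

Definition rend2 : Type := rtens rend_ract rend_lact.
HB.instance Definition _ := Vector.on rend2.

(* c |-> alpha_(1)(c_(1)) (x) alpha_(2)(c_(2)), for                           *)
(* t = alpha_(1) (x) alpha_(2).                                               *)
Definition rend2_eval (t : rend2) (c : C) : tens C C :=
  rlift rend_ract rend_lact
    (fun alpha beta : rend => tmap alpha beta (comul c)) t.

Definition is_rend_comul (Delta : 'Hom(rend, rend2)) : Prop :=
  forall (alpha : rend) (t : rend2),
    t = Delta alpha <-> forall c, rend2_eval t c = comul (alpha c).

Lemma rhit_is_linear (a : k) (phi eta : dual C) :
  rhit (a *: phi + eta) = a *: rhit phi + rhit eta.
Proof.
apply/lfunP=> u; rewrite add_lfunE scale_lfunE !comp_lfunE.
elim/tens_ind: (comul u) => [p q|v w IHv IHw].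
  rewrite !(tliftE _ _ (rhit_bilin _ _)) add_lfunE scale_lfunE.
  by rewrite scalerDl scalerA.
by rewrite !linearD /= IHv IHw addrACA -scalerDr.
Qed.

Lemma lhit_is_linear (a : k) (phi eta : dual C) :
  lhit (a *: phi + eta) = a *: lhit phi + lhit eta.
Proof.
apply/lfunP=> u; rewrite add_lfunE scale_lfunE !comp_lfunE.
elim/tens_ind: (comul u) => [p q|v w IHv IHw].
  rewrite !(tliftE _ _ (lhit_bilin _ _)) add_lfunE scale_lfunE.
  by rewrite scalerDl scalerA.
by rewrite !linearD /= IHv IHw addrACA -scalerDr.
Qed.

Lemma rend_lact_bilin : bilin rend_lact.
Proof.
apply: bilinP => [a x y z|a z x y]; apply/val_inj => /=.
  by rewrite lhit_is_linear comp_lfunDr -comp_lfunZr.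
by rewrite comp_lfunDl -comp_lfunZl.
Qed.

Lemma rend_ract_bilin : bilin rend_ract.
Proof.
apply: bilinP => [a x y z|a z x y]; apply/val_inj => /=.
  by rewrite comp_lfunDl -comp_lfunZl.
by rewrite rhit_is_linear comp_lfunDr -comp_lfunZr.
Qed.

Lemma rend2_evalE (alpha beta : rend) c :
  rend2_eval (rtmul rend_ract rend_lact alpha beta) c =
  tmap alpha beta (comul c).
Proof.
have mb := tmap_bilin C C C C.
rewrite /rend2_eval rliftE //; last 1 first.
- move=> m l n; rewrite /rend_fun /= (tmap_splitl (rhit _)) rhit_lhit_comul.
  by rewrite [in RHS](tmap_splitr _ (lhit _)).
- exact: rend_ract_bilin.
- exact: rend_lact_bilin.
apply: bilinP => [a u v z|a z u v]; rewrite /rend_fun /=.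
  by rewrite (proj1 mb) add_lfunE scale_lfunE.
by rewrite (proj2 mb) add_lfunE scale_lfunE.
Qed.

End RightBialgebroid.

Section AntiIsomorphism.

Variables (k : fieldType) (C D : coalgType k) (g : coalgHom C D).
Local Notation f := (dual_hom g).
Local Notation R := (subvs_of (centralizer f)).
Local Notation E := (rend g).
Local Notation S := (lend f).
Local Notation E2 := (rend2 g).
Local Notation S2 := (lend2 f).

Definition rtens_map (Phi : 'Hom(E, S)) : 'Hom(E2, S2) :=
  rlift (@rend_ract _ _ _ g) (@rend_lact _ _ _ g)
    (fun alpha beta : E =>
       rtmul (@lend_ract _ _ _ f) (@lend_lact _ _ _ f) (Phi alpha) (Phi beta)).

Record bialgebroid_anti_iso (DE : 'Hom(E, E2)) (DS : 'Hom(S, S2))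
    (Phi : 'Hom(E, S)) : Prop := BialgebroidAntiIso {
  bai_bij : bijective Phi;
  bai_mul : forall alpha beta : E,
    Phi (rend_mul alpha beta) = lend_mul (Phi beta) (Phi alpha);
  bai_one : Phi (rend_one g) = lend_one f;
  bai_src : forall r : R, Phi (rend_tgt r) = lend_src r;
  bai_tgt : forall r : R, Phi (rend_src r) = lend_tgt r;
  bai_lact : forall (r : R) (alpha : E),
    Phi (rend_lact r alpha) = lend_lact r (Phi alpha);
  bai_ract : forall (alpha : E) (s : R),
    Phi (rend_ract alpha s) = lend_ract (Phi alpha) s;
  bai_comul : forall alpha : E, DS (Phi alpha) = rtens_map Phi (DE alpha);
  bai_counit : forall alpha : E, lend_counit (Phi alpha) = rend_counit alpha
}.

(* DE and DS are determined by the conditions is_rend_comul and is_lend_comul, *)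
(* which express the unique existence of the values of the coproducts.        *)
Definition bialgebroids_anti_isomorphic : Prop :=
  exists (DE : 'Hom(E, E2)) (DS : 'Hom(S, S2)),
    [/\ is_rend_comul DE, is_lend_comul DS
      & exists Phi : 'Hom(E, S), bialgebroid_anti_iso DE DS Phi].

End AntiIsomorphism.

(* Main.v *)
Require Import Defs.
From mathcomp Require Import all_boot all_order all_algebra.

(** The vector space dual turns coalgebras into algebras and exchanges the
    two notions, and finite dimensionality makes it lose nothing.

    For coalgebras D and E, the dual of a D-E-bicomodule is a
    D^*-E^*-bimodule.  Rather than one particular dual, a bimodule M' is said
    to be dual to a bicomodule M when a perfect pairing of M' with M carries
    the actions to the coactions (dual_pair).  Linear maps M -> N then
    correspond to linear maps N' -> M' by transposition, and since the elements
    of D^* separate the points of D, a map is colinear exactly when its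
    transpose is linear over D^* and E^* (adjoint_hom).

    Two dual pairs matter.  The dual of C is A, with the restricted actions
    (corestr_dual_pair).  The dual of M []_D N is M' (x)_B N'
    (cotens_dual_pair): the first is the kernel of a map, the second the
    cokernel of its transpose, so the cotensor product is the annihilator of
    the relations defining the tensor product (cotens_annihilator).

    Being a direct summand of a power N^n means having n homomorphisms
    u_i : M -> N and n homomorphisms v_i : N -> M with \sum_i v_i u_i = 1
    (bimod_summand_powP, bicomod_summand_powP).  This condition is visibly
    self-dual, so codepth two for g and depth two for g^* are the same
    condition (left_codepth_depth, right_codepth_depth).

    For the bialgebroids, transposition alpha |-> (phi |-> phi \o alpha) is a
    bijection End(^D C^D) -> End(_B A_B), and it visibly matches all the
    structure except the coproducts, whose existence has to be established.
    On the side of S = End(_B A_B), left depth two provides elements t_i of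
    A (x)_B A commuting with B and maps beta_i in S such that
    x (x) 1 = \sum_i t_i beta_i(x).  Writing t_i = t_i^1 (x) t_i^2, every
    s in S (x)_R S is then recovered from the map
    s(x, y) = s_(1)(x) s_(2)(y) that it induces, as
    \sum_i s(-, t_i^1) t_i^2 (x) beta_i (left_lend2_decomposition): this shows
    that a coproduct is unique, and the same formula applied to
    (x, y) |-> alpha(xy) shows that it exists (left_lend2_eval_sur).  Right
    depth two is the mirror image.  Finally, transposition carries the
    condition that characterises the coproduct of S to the one that
    characterises the coproduct of End(^D C^D), so the latter coproduct exists
    too and corresponds to the former. *)

Set Implicit Arguments.
Unset Strict Implicit.
Unset Printing Implicit Defensive.

Import GRing.Theory.
Local Open Scope ring_scope.

(** * Functionals on tensor products *)

Section Functionals.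

Variable k : fieldType.
Implicit Types U V W X : vectType k.

Lemma lfun_surj_invK V W (p : 'Hom(V, W)) :
  (forall w, exists v, w = p v) -> cancel (p^-1)%VF p.
Proof.
by move=> ps w; apply: limg_lfunVK; have [v ->] := ps w; rewrite memv_img ?memvf.
Qed.

Definition fmul V W (x : 'Hom(V, k^o)) (y : 'Hom(W, k^o)) :
  'Hom(tens V W, k^o) := tlift (fun a b => (x a : k) * y b : k^o).

Lemma fmul_pure_bilin V W (x : 'Hom(V, k^o)) (y : 'Hom(W, k^o)) :
  bilin (fun a b => (x a : k) * y b : k^o).
Proof.
apply: bilinP => [a u u' v|a u v v']; rewrite linearP /=.
  by rewrite mulrDl -mulrA.
by rewrite mulrDr mulrCA.
Qed.

Lemma fmulE V W (x : 'Hom(V, k^o)) (y : 'Hom(W, k^o)) v w :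
  fmul x y (v \ox w) = (x v : k) * y w.
Proof. by rewrite tliftE //; apply: fmul_pure_bilin. Qed.

Lemma fmul_bilin V W : bilin (@fmul V W).
Proof.
apply: bilinP => [a x x' y|a x y y']; apply: tens_ext => v w;
  rewrite add_lfunE scale_lfunE !fmulE add_lfunE scale_lfunE.
  by rewrite mulrDl; congr (_ + _); rewrite -mulrA.
by rewrite mulrDr; congr (_ + _); rewrite mulrCA.
Qed.

Lemma fmul_tmap U V W X (x : 'Hom(V, k^o)) (y : 'Hom(W, k^o))
    (u : 'Hom(U, V)) (v : 'Hom(X, W)) t :
  fmul x y (tmap u v t) = fmul (x \o u)%VF (y \o v)%VF t.
Proof.
elim/tens_ind: t => [a b|t t' IH IH']; last by rewrite !linearD /= IH IH'.
by rewrite tmapE !fmulE !comp_lfunE.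
Qed.

Lemma fmulA U V W (x : 'Hom(U, k^o)) (y : 'Hom(V, k^o)) (z : 'Hom(W, k^o)) t :
  fmul (fmul x y) z (tassoc U V W t) = fmul x (fmul y z) t.
Proof.
elim/tens_ind: t => [u s|t t' IH IH']; last by rewrite !linearD /= IH IH'.
elim/tens_ind: s => [v w|t t' IH IH'].
  by rewrite tassocE !fmulE mulrA.
by rewrite (bilinDr (tmul_bilin _ _)) !linearD /= IH IH'.
Qed.

(** Functionals on a tensor product of finite dimensional spaces are sums of
    products of functionals, so that they can be handled one product at a time. *)
Lemma fmul_ind V W (P : 'Hom(tens V W, k^o) -> Prop) :
  (forall x y, P (fmul x y)) -> (forall z z', P z -> P z' -> P (z + z')) ->
  forall z, P z.
Proof.
move=> Pm PD z; have P0 : P 0 by rewrite -(bilin0l (fmul_bilin _ _) 0).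
pose cV i : 'Hom(V, k^o) := linfun (coord (vbasis {:V}) i : V -> k^o).
pose cW j : 'Hom(W, k^o) := linfun (coord (vbasis {:W}) j : W -> k^o).
have -> : z = \sum_(i < \dim {:V}) \sum_(j < \dim {:W})
    fmul (z ((vbasis {:V})`_i \ox (vbasis {:W})`_j) *: cV i) (cW j).
  apply/lfunP=> t; rewrite {1}[t]tens_basis linear_sum sum_lfunE.
  apply: eq_bigr => i _; rewrite linear_sum sum_lfunE.
  apply: eq_bigr => j _; rewrite linearZ /= (bilinZl (fmul_bilin _ _)).
  rewrite scale_lfunE /= [LHS]mulrC; congr (_ * _).
  elim/tens_ind: t => [v w|t t' IH IH']; last first.
    by rewrite linearD /= -IH -IH'; apply: mxE.
  by rewrite mxE fmulE !lfunE.
by apply: big_ind => // i _; apply: big_ind => // j _.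
Qed.

(** This is how identities between coactions are reduced to identities
    between the actions dual to them. *)
Lemma fmul_separates V W (t t' : tens V W) :
  (forall x y, fmul x y t = fmul x y t') -> t = t'.
Proof.
move=> tt'; apply: dual_separates; elim/fmul_ind => // z z' IH IH'.
by rewrite !add_lfunE IH IH'.
Qed.

End Functionals.

(** * Perfect pairings and transposes *)

Section Perfect.

Variable k : fieldType.
Implicit Types M N : vectType k.

(** Surjectivity onto both dual spaces, rather than bijectivity of p, because
    it is what passes directly to tensor products, subspaces and quotients;
    since functionals separate points, both injectivities follow. *)
Definition perfect M' M (p : 'Hom(M', 'Hom(M, k^o))) : Prop :=
  (forall x : 'Hom(M, k^o), exists m', x = p m') /\
  (forall y : 'Hom(M', k^o), exists m, forall m', y m' = p m' m).

Lemma perfect_injl M' M (p : 'Hom(M', 'Hom(M, k^o))) x y :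
  perfect p -> (forall m, p x m = p y m) -> x = y.
Proof.
by case=> _ ps pxy; apply: dual_separates => b; have [m bE] := ps b; rewrite !bE.
Qed.

Lemma perfect_injr M' M (p : 'Hom(M', 'Hom(M, k^o))) x y :
  perfect p -> (forall m', p m' x = p m' y) -> x = y.
Proof.
by case=> ps _ pxy; apply: dual_separates => b; have [m' ->] := ps b.
Qed.

Definition lflip M' M (p : 'Hom(M', 'Hom(M, k^o))) : 'Hom(M, 'Hom(M', k^o)) :=
  linfun (fun m => linfun (fun m' => p m' m)).

Lemma lflipE M' M (p : 'Hom(M', 'Hom(M, k^o))) m m' : lflip p m m' = p m' m.
Proof.
have pl n : linear (fun m' => p m' n).
  by move=> a x y; rewrite linearP add_lfunE scale_lfunE.
rewrite (linfunE (f := fun m => linfun (fun m' => p m' m))).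
  by rewrite (linfunE (pl m)).
move=> a x y; apply/lfunP=> z; rewrite add_lfunE scale_lfunE !(linfunE (pl _)).
exact: linearP.
Qed.

Lemma perfect_flip M' M (p : 'Hom(M', 'Hom(M, k^o))) :
  perfect p -> perfect (lflip p).
Proof.
case=> pl pr; split=> [y|x].
  by have [m ym] := pr y; exists m; apply/lfunP=> m'; rewrite lflipE.
by have [m' ->] := pl x; exists m' => m; rewrite lflipE.
Qed.

Definition adjoint M' M N' N (p : 'Hom(M', 'Hom(M, k^o)))
    (q : 'Hom(N', 'Hom(N, k^o))) (phi : 'Hom(M, N)) (phi' : 'Hom(N', M')) :=
  forall n' m, p (phi' n') m = q n' (phi m).

(** The partial inverse p^-1 is a true right inverse when p is perfect; using
    it makes the transpose linear without further choices. *)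
Definition transp M' M N' N (p : 'Hom(M', 'Hom(M, k^o)))
    (q : 'Hom(N', 'Hom(N, k^o))) (phi : 'Hom(M, N)) : 'Hom(N', M') :=
  (p^-1 \o linfun (fun n' => (q n' \o phi)%VF))%VF.

Lemma transpP M' M N' N (p : 'Hom(M', 'Hom(M, k^o)))
    (q : 'Hom(N', 'Hom(N, k^o))) phi :
  perfect p -> adjoint p q phi (transp p q phi).
Proof.
case=> pl _ n' m; rewrite comp_lfunE lfun_surj_invK // linfunE ?comp_lfunE //.
by move=> a x y; rewrite linearP comp_lfunDl comp_lfunZl.
Qed.

(** Perfect pairings being symmetric, every map N' -> M' is itself a
    transpose. *)
Lemma transp_flipP M' M N' N (p : 'Hom(M', 'Hom(M, k^o)))
    (q : 'Hom(N', 'Hom(N, k^o))) phi' :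
  perfect q -> adjoint p q (transp (lflip q) (lflip p) phi') phi'.
Proof.
move=> qP n' m; have := transpP (lflip p) phi' (perfect_flip qP) m n'.
by rewrite !lflipE.
Qed.

(** Transposition reverses composition, so it exchanges the two families:
    both sides evaluate to the same numbers under the pairing. *)
Lemma adjoint_retract n M' M N' N (p : 'Hom(M', 'Hom(M, k^o)))
    (q : 'Hom(N', 'Hom(N, k^o))) (u : 'I_n -> 'Hom(M, N)) u'
    (v : 'I_n -> 'Hom(N, M)) v' :
  perfect p -> (forall i, adjoint p q (u i) (u' i)) ->
  (forall i, adjoint q p (v i) (v' i)) ->
  (\sum_i (v i \o u i)%VF = \1%VF) <-> (\sum_i (u' i \o v' i)%VF = \1%VF).
Proof.
move=> pP uu' vv'.
have E m m' : p m' ((\sum_i (v i \o u i)%VF) m) = p ((\sum_i (u' i \o v' i)%VF) m') m.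
  rewrite !sum_lfunE !linear_sum sum_lfunE; apply: eq_bigr => i _ /=.
  by rewrite !comp_lfunE uu' vv'.
split=> e; apply/lfunP=> m; rewrite id_lfunE.
  by apply: (perfect_injl pP) => x; rewrite -E e id_lfunE.
by apply: (perfect_injr pP) => x; rewrite E e id_lfunE.
Qed.

End Perfect.

(** * Dual pairs of a bicomodule and a bimodule *)

Section DualPairs.

Variables (k : fieldType) (D E : coalgType k).

(** M' is the dual bimodule of M: (b . x)(m) = b(m_(-1)) x(m_(0)) and
    (x . e)(m) = x(m_(0)) e(m_(1)). *)
Record dual_pair (M : bicomod D E) (M' : bimod (dual D) (dual E))
    (p : 'Hom(M', 'Hom(M, k^o))) : Prop := DualPair {
  dp_perfect : perfect p;
  dp_lact : forall b m' m, p (lact b m') m = fmul b (p m') (lco M m);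
  dp_ract : forall m' e m, p (ract m' e) m = fmul (p m') e (rco M m)
}.

(** Paired with n' and m, the colinearity of phi against a functional b is the
    linearity of phi' for the action of b; all functionals together detect
    equality in D (x) N. *)
Lemma adjoint_hom (M N : bicomod D E) (M' N' : bimod (dual D) (dual E))
    (p : 'Hom(M', 'Hom(M, k^o))) (q : 'Hom(N', 'Hom(N, k^o)))
    (phi : 'Hom(M, N)) (phi' : 'Hom(N', M')) :
  dual_pair p -> dual_pair q -> adjoint p q phi phi' ->
  bicomod_hom phi <-> bimod_hom phi'.
Proof.
move=> [pP pl pr] [qP ql qr] a.
have ac n' : (q n' \o phi)%VF = p (phi' n').
  by apply/lfunP=> m; rewrite comp_lfunE a.
have L b n' m : p (lact b (phi' n')) m = fmul b (q n') (tmap \1 phi (lco M m)).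
  by rewrite pl fmul_tmap comp_lfun1r ac.
have L' b n' m : p (phi' (lact b n')) m = fmul b (q n') (lco N (phi m)).
  by rewrite a ql.
have R e n' m : p (ract (phi' n') e) m = fmul (q n') e (tmap phi \1 (rco M m)).
  by rewrite pr fmul_tmap comp_lfun1r ac.
have R' e n' m : p (phi' (ract n' e)) m = fmul (q n') e (rco N (phi m)).
  by rewrite a qr.
split=> [[hl hr]|[hl hr]]; split.
- move=> b n'; apply: (perfect_injl pP) => m; rewrite L L'.
  by rewrite -[lco N _]comp_lfunE -hl comp_lfunE.
- move=> n' e; apply: (perfect_injl pP) => m; rewrite R R'.
  by rewrite -[rco N _]comp_lfunE -hr comp_lfunE.
- apply/lfunP=> m; rewrite !comp_lfunE; apply: fmul_separates => x y.
  by have [n' ->] := qP.1 y; rewrite -L -L' hl.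
apply/lfunP=> m; rewrite !comp_lfunE; apply: fmul_separates => x y.
by have [n' ->] := qP.1 x; rewrite -R -R' hr.
Qed.

End DualPairs.

Section CorestrictionDual.

Variables (k : fieldType) (C D E : coalgType k).
Variables (g : coalgHom C D) (h : coalgHom C E).
Variables (f : algHom (dual D) (dual C)) (f' : algHom (dual E) (dual C)).

(** A finite dimensional space is its own bidual. *)
Lemma perfect_id (V : vectType k) :
  perfect (\1%VF : 'Hom('Hom(V, k^o), 'Hom(V, k^o))).
Proof.
split=> [x|y]; first by exists x; rewrite id_lfunE.
pose c i : 'Hom(V, k^o) := linfun (coord (vbasis {:V}) i : V -> k^o).
exists (\sum_(i < \dim {:V}) (y (c i) : k) *: (vbasis {:V})`_i) => x.
rewrite id_lfunE linear_sum.
have {1}-> : x = \sum_(i < \dim {:V}) (x (vbasis {:V})`_i : k) *: c i.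
  apply/lfunP=> v; rewrite {1}[v](coord_vbasis (memvf v)) linear_sum sum_lfunE.
  apply: eq_bigr => i _; rewrite linearZ scale_lfunE /= [RHS]mulrC.
  by rewrite /c lfunE.
rewrite linear_sum; apply: eq_bigr => i _; rewrite !linearZ /=.
exact: mulrC.
Qed.

(** Only the values of f and f' are constrained: the identity of the algebra
    dual C is not literally the dual of the identity of C, and both must be
    covered. *)
Lemma corestr_dual_pair :
  (forall d : dual D, f d = (d \o g)%VF) ->
  (forall d : dual E, f' d = (d \o h)%VF) ->
  @dual_pair _ _ _ (corestr g h) (restr f f') (\1%VF : 'Hom(dual C, 'Hom(C, k^o))).
Proof.
move=> fE f'E; split=> [|b m' m|m' e m]; first exact: perfect_id.
  rewrite !id_lfunE /= /restr_lact fE /corestr_lco.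
  by rewrite !comp_lfunE fmul_tmap comp_lfun1r.
rewrite !id_lfunE /= /restr_ract f'E /corestr_rco.
by rewrite !comp_lfunE fmul_tmap comp_lfun1r.
Qed.

End CorestrictionDual.

(** * The dual of a cotensor product *)

Section TensorPairing.

Variables (k : fieldType) (M' M N' N : vectType k).
Variables (p : 'Hom(M', 'Hom(M, k^o))) (q : 'Hom(N', 'Hom(N, k^o))).

Definition tpair : 'Hom(tens M' N', 'Hom(tens M N, k^o)) :=
  tlift (fun m' n' => fmul (p m') (q n')).

Lemma tpairE m' n' : tpair (m' \ox n') = fmul (p m') (q n').
Proof.
rewrite tliftE //; have [fl fr] := fmul_bilin M N.
by apply: bilinP => [a x x' y|a x y y']; rewrite linearP ?fl ?fr.
Qed.

Lemma tpair_pureE t m n : tpair t (m \ox n) = fmul (lflip p m) (lflip q n) t.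
Proof.
elim/tens_ind: t => [m' n'|t t' IH IH'].
  by rewrite tpairE !fmulE !lflipE.
by rewrite !linearD add_lfunE /= IH IH'.
Qed.

Lemma perfect_tens : perfect p -> perfect q -> perfect tpair.
Proof.
move=> [pl pr] [ql qr]; split; elim/fmul_ind.
- move=> x y; have [m' ->] := pl x; have [n' ->] := ql y.
  by exists (m' \ox n'); rewrite tpairE.
- by move=> z z' [t ->] [t' ->]; exists (t + t'); rewrite linearD.
- move=> x y; have [m xE] := pr x; have [n yE] := qr y; exists (m \ox n) => t.
  rewrite tpair_pureE; congr (fmul _ _ t).
    by apply/lfunP=> m'; rewrite lflipE.
  by apply/lfunP=> n'; rewrite lflipE.
move=> z z' [t zt] [t' zt']; exists (t + t') => s.
by rewrite add_lfunE linearD zt zt'.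
Qed.

End TensorPairing.

Section CotensorDual.

Variables (k : fieldType) (D' D E' : coalgType k).
Variables (M : bicomod D' D) (N : bicomod D E').
Variables (M' : bimod (dual D') (dual D)) (N' : bimod (dual D) (dual E')).
Variables (p : 'Hom(M', 'Hom(M, k^o))) (q : 'Hom(N', 'Hom(N, k^o))).
Hypotheses (pP : dual_pair p) (qP : dual_pair q).

Local Notation K := (cotens M N).
Local Notation W := (bal_rel M' N').
Local Notation T := (tpair p q).
Local Notation bal := (bal_map (@ract _ _ _ M') (@lact _ _ _ N')).

(** The maps whose kernel is the cotensor product and whose image is the
    relations of the tensor product are transposes of each other. *)
Lemma tpair_bal m' b n' x :
  T (bal ((m' \ox b) \ox n')) x =
  fmul (fmul (p m') b) (q n') (cotens_map M N x).
Proof.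
rewrite (bal_mapE (ract_bilin M') (lact_bilin N')) linearB /= !tpairE.
rewrite add_lfunE opp_lfunE [in RHS]add_lfunE opp_lfunE linearB /= comp_lfunE.
congr (_ - _); last first.
  rewrite fmulA fmul_tmap comp_lfun1r; congr (fmul _ _ x).
  by apply/lfunP=> n; rewrite (dp_lact qP) comp_lfunE.
rewrite fmul_tmap comp_lfun1r; congr (fmul _ _ x).
by apply/lfunP=> m; rewrite (dp_ract pP) comp_lfunE.
Qed.

Lemma cotens_annihilator x :
  x \in K <-> (forall w, w \in W -> T w x = 0).
Proof.
split=> [xK _ /memv_imgP[s _ ->]|xW].
  elim/tens_ind: s => [s n'|s s' IH IH']; last by rewrite !linearD add_lfunE IH IH' addr0.
  elim/tens_ind: s => [m' b|s s' IH IH'].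
    rewrite tpair_bal; move: xK; rewrite memv_ker => /eqP ->.
    exact: linear0.
  by rewrite (bilinDl (tmul_bilin _ _)) !linearD add_lfunE IH IH' addr0.
rewrite memv_ker; apply/eqP; apply: fmul_separates => z y; rewrite linear0.
have [n' ->] := (dp_perfect qP).1 y.
elim/fmul_ind: z => [a b|z z' IH IH'].
  have [m' ->] := (dp_perfect pP).1 a.
  by rewrite -tpair_bal xW // memv_img ?memvf.
by rewrite (bilinDl (fmul_bilin _ _)) add_lfunE IH IH' addr0.
Qed.

(** The value on a class does not depend on the representative, by
    cotens_annihilator. *)
Definition cotens_pair :
    'Hom(rtens_bimod M' N', 'Hom(cotens_bicomod M N, k^o)) :=
  linfun (fun t : quo W => (T (quo_repr W t) \o linfun (@vsval _ _ K))%VF).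

Lemma cotens_pairE (t : quo W) (x : subvs_of K) :
  cotens_pair t x = T (quo_repr W t) (vsval x).
Proof.
rewrite linfunE; first by rewrite comp_lfunE [X in _ X = _]lfunE.
by move=> a u u'; rewrite linearP /= linearP comp_lfunDl comp_lfunZl.
Qed.

Lemma cotens_pair_pi v (x : subvs_of K) : cotens_pair (quo_pi W v) x = T v (vsval x).
Proof.
rewrite cotens_pairE; apply/eqP; rewrite -subr_eq0.
rewrite -opp_lfunE -add_lfunE -linearB; apply/eqP.
by have/cotens_annihilator := subvsP x; apply; apply: quo_piK.
Qed.

(** A functional on the subspace K extends to the whole tensor product; a
    functional on the quotient by W is a functional vanishing on W, hence the
    evaluation at a point of the annihilator K of W. *)
Lemma perfect_cotens : perfect cotens_pair.
Proof.
have [Tl Tr] := perfect_tens (dp_perfect pP) (dp_perfect qP).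
split=> [x|y].
  have [v vE] := Tl (x \o linfun (vsproj K))%VF.
  exists (quo_pi W v); apply/lfunP=> u.
  by rewrite cotens_pair_pi -vE comp_lfunE; congr (x _); rewrite lfunE /= vsvalK.
have [x xE] := Tr (y \o quo_pi W)%VF.
have xK : x \in K.
  apply/cotens_annihilator => w wW; rewrite -xE comp_lfunE.
  by move: wW; rewrite -quo_pi_eq0 => /eqP ->; apply: linear0.
by exists (Subvs xK) => t; rewrite cotens_pairE -xE comp_lfunE quo_reprK.
Qed.

Lemma cotens_lcoE (x : cotens_bicomod M N) :
  tmap (\1%VF : 'End(D')) (linfun (@vsval _ _ K)) (lco (cotens_bicomod M N) x) =
  tens_lco M N (vsval x).
Proof.
have /lfunP/(_ x) := sub_lcoE (cotens_stable M N) ord0.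
by rewrite !comp_lfunE => ->; rewrite lfunE.
Qed.

Lemma cotens_rcoE (x : cotens_bicomod M N) :
  tmap (linfun (@vsval _ _ K)) (\1%VF : 'End(E')) (rco (cotens_bicomod M N) x) =
  tens_rco M N (vsval x).
Proof.
have /lfunP/(_ x) := sub_rcoE (cotens_stable M N) ord0.
by rewrite !comp_lfunE => ->; rewrite lfunE.
Qed.

Lemma cotens_dual_pair : dual_pair cotens_pair.
Proof.
have piE (t : quo W) : (T (quo_repr W t) \o linfun (@vsval _ _ K))%VF =
    cotens_pair t.
  apply/lfunP=> x; rewrite comp_lfunE cotens_pairE; congr (T _ _).
  by rewrite lfunE.
split=> [|b t x|t e x]; first exact: perfect_cotens.
  transitivity (fmul b (T (quo_repr W t)) (tens_lco M N (vsval x))); last first.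
    by rewrite -cotens_lcoE fmul_tmap comp_lfun1r piE.
  rewrite cotens_pair_pi; move: (quo_repr W t) (vsval x) => {}t {}x /=.
  elim/tens_ind: x => [m n|x x' IH IH']; last by rewrite !linearD /= IH IH'.
  elim/tens_ind: t => [m' n'|t t' IH IH']; last first.
    rewrite /= (bilinDr (tens_lact_bilin _ _)) !linearD add_lfunE IH IH'.
    by rewrite (bilinDr (fmul_bilin _ _)) add_lfunE.
  rewrite /= tens_lactE !tpairE fmulE (dp_lact pP) comp_lfunE tmapE id_lfunE.
  elim/tens_ind: (lco M m) => [d a|s s' IH IH'].
    by rewrite tassocVE !fmulE mulrA.
  by rewrite (bilinDl (tmul_bilin _ _)) !linearD mulrDl /= IH IH'.
transitivity (fmul (T (quo_repr W t)) e (tens_rco M N (vsval x))); last first.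
  by rewrite -cotens_rcoE fmul_tmap comp_lfun1r piE.
rewrite cotens_pair_pi; move: (quo_repr W t) (vsval x) => {}t {}x /=.
elim/tens_ind: x => [m n|x x' IH IH']; last by rewrite !linearD /= IH IH'.
elim/tens_ind: t => [m' n'|t t' IH IH']; last first.
  rewrite /= (bilinDl (tens_ract_bilin _ _)) !linearD add_lfunE IH IH'.
  by rewrite (bilinDl (fmul_bilin _ _)) add_lfunE.
rewrite /= tens_ractE !tpairE fmulE (dp_ract qP) comp_lfunE tmapE id_lfunE.
elim/tens_ind: (rco N n) => [a d|s s' IH IH'].
  by rewrite tassocE !fmulE mulrA.
by rewrite (bilinDr (tmul_bilin _ _)) !linearD mulrDr /= IH IH'.
Qed.

End CotensorDual.

(** * Complemented subspaces and retractions *)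

Section Splitting.

Variables (k : fieldType) (V : vectType k) (P Q : {vspace V}).

Definition sub_incl : 'Hom(subvs_of P, V) := linfun vsval.
Definition sub_proj : 'Hom(V, subvs_of P) :=
  (linfun (vsproj P) \o daddv_pi P Q)%VF.

Lemma sub_inclE u : sub_incl u = vsval u. Proof. by rewrite lfunE. Qed.

Hypothesis PQ0 : (P :&: Q = 0)%VS.

Lemma sub_proj_incl : (sub_proj \o sub_incl = \1)%VF.
Proof.
apply/lfunP=> u; rewrite !comp_lfunE sub_inclE lfunE id_lfunE /=.
by rewrite daddv_pi_id ?subvsP // vsvalK.
Qed.

Lemma sub_proj_id v : v \in P -> vsval (sub_proj v) = v.
Proof. by move=> vP; rewrite !comp_lfunE lfunE /= vsprojK ?daddv_pi_id // ?memv_pi. Qed.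

Lemma sub_proj0 v : v \in Q -> sub_proj v = 0.
Proof.
move=> vQ; rewrite comp_lfunE; suff -> : daddv_pi P Q v = 0 by rewrite linear0.
have v1 : v \in (P + Q)%VS by rewrite -[v]add0r memv_add ?mem0v.
have := daddv_pi_add PQ0 v1.
have QP0 : (Q :&: P = 0)%VS by rewrite capvC.
rewrite (daddv_pi_id QP0 vQ) => /eqP.
by rewrite -[X in _ == X]add0r (can_eq (addrK _)) => /eqP.
Qed.

Hypothesis PQT : (P + Q = fullv)%VS.

Lemma split_ind (T : V -> Prop) : (forall v, v \in P -> T v) ->
  (forall v, v \in Q -> T v) -> (forall v w, T v -> T w -> T (v + w)) ->
  forall v, T v.
Proof.
move=> TP TQ TD v; have /memv_addP[p pP [q qQ ->]] : v \in (P + Q)%VS.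
  by rewrite PQT memvf.
by apply: TD; [apply: TP|apply: TQ].
Qed.

End Splitting.

Section Retract.

Variables (k : fieldType) (M N : vectType k) (i : 'Hom(M, N)) (r : 'Hom(N, M)).
Hypothesis ri : (r \o i = \1)%VF.

Lemma retractK m : r (i m) = m.
Proof. by rewrite -comp_lfunE ri id_lfunE. Qed.

Lemma retract_add : (limg i + lker r = fullv)%VS.
Proof.
apply/eqP; rewrite eqEsubv subvf; apply/subvP=> v _.
rewrite -[v](subrK (i (r v))) addrC memv_add ?memv_img ?memvf //.
by rewrite memv_ker linearB /= retractK subrr.
Qed.

Lemma retract_cap : (limg i :&: lker r = 0)%VS.
Proof.
apply/eqP; rewrite -subv0; apply/subvP=> v; rewrite memv_cap memv0.
by case/andP=> /memv_imgP[m _ ->]; rewrite memv_ker retractK => /eqP ->; rewrite linear0.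
Qed.

Definition retract_iso : 'Hom(M, subvs_of (limg i)) :=
  (linfun (vsproj (limg i)) \o i)%VF.

Lemma retract_isoE m : vsval (retract_iso m) = i m.
Proof. by rewrite comp_lfunE lfunE /= vsprojK // memv_img ?memvf. Qed.

Lemma retract_iso_bij : bijective retract_iso.
Proof.
exists (fun v => r (vsval v)) => [m|v]; first by rewrite retract_isoE retractK.
apply: val_inj; rewrite /= retract_isoE.
by have /memv_imgP[m _ ->] := subvsP v; rewrite retractK.
Qed.

End Retract.

Section FfunMaps.

Variables (k : fieldType) (V : vectType k) (n : nat).

Definition ffun_pr (i : 'I_n) : 'Hom({ffun 'I_n -> V}, V) :=
  linfun (fun f : {ffun 'I_n -> V} => f i).
Definition ffun_inj (i : 'I_n) : 'Hom(V, {ffun 'I_n -> V}) :=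
  linfun (fun v : V => [ffun j => if j == i then v else 0]).

Lemma ffun_prE i f : ffun_pr i f = f i.
Proof. by rewrite linfunE // => a x y; rewrite !ffunE. Qed.

Lemma ffun_injE i m : ffun_inj i m = [ffun j => if j == i then m else 0].
Proof.
rewrite linfunE // => a x y; apply/ffunP=> j; rewrite !ffunE.
by case: eqP; rewrite // scaler0 addr0.
Qed.

Lemma ffun_pr_inj i j v : ffun_pr i (ffun_inj j v) = if i == j then v else 0.
Proof. by rewrite ffun_injE ffun_prE ffunE. Qed.

Lemma sum_ffun_inj_pr : (\sum_i (ffun_inj i \o ffun_pr i)%VF) = \1%VF.
Proof.
apply/lfunP=> f; rewrite sum_lfunE id_lfunE; apply/ffunP=> j.
rewrite sum_ffunE (bigD1 j) //= comp_lfunE ffun_prE ffun_injE ffunE eqxx.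
rewrite big1 ?addr0 // => i ij.
by rewrite comp_lfunE ffun_prE ffun_injE ffunE eq_sym (negbTE ij).
Qed.

Variable (U : vectType k).

(** A retraction through a power is a family of maps to and from the factor;
    stated for abstract predicates so as to serve both for bimodule and for
    bicomodule homomorphisms. *)
Lemma ffun_retractP (HU : 'Hom(U, V) -> Prop) (HV : 'Hom(V, U) -> Prop)
    (HUn : 'Hom(U, {ffun 'I_n -> V}) -> Prop)
    (HVn : 'Hom({ffun 'I_n -> V}, U) -> Prop) :
  (forall i phi, HUn phi -> HU (ffun_pr i \o phi)%VF) ->
  (forall i phi, HVn phi -> HV (phi \o ffun_inj i)%VF) ->
  (forall u : 'I_n -> 'Hom(U, V), (forall i, HU (u i)) ->
     HUn (\sum_i (ffun_inj i \o u i)%VF)) ->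
  (forall v : 'I_n -> 'Hom(V, U), (forall i, HV (v i)) ->
     HVn (\sum_i (v i \o ffun_pr i)%VF)) ->
  (exists (i : 'Hom(U, {ffun 'I_n -> V})) (r : 'Hom({ffun 'I_n -> V}, U)),
     [/\ HUn i, HVn r & (r \o i = \1)%VF]) <->
  (exists (u : 'I_n -> 'Hom(U, V)) (v : 'I_n -> 'Hom(V, U)),
     [/\ forall i, HU (u i), forall i, HV (v i)
    & \sum_i (v i \o u i)%VF = \1%VF]).
Proof.
move=> pU pV qU qV; split=> [[i [r [iP rP ri]]]|[u [v [uP vP uv]]]].
  exists (fun j => ffun_pr j \o i)%VF, (fun j => r \o ffun_inj j)%VF.
  split=> [j|j|]; [exact: pU|exact: pV|].
  rewrite -ri -[i in RHS]comp_lfun1l -sum_ffun_inj_pr.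
  apply/lfunP=> x; rewrite sum_lfunE comp_lfunE comp_lfunE sum_lfunE.
  by rewrite linear_sum; apply: eq_bigr => j _; rewrite !comp_lfunE.
exists (\sum_i (ffun_inj i \o u i)%VF), (\sum_i (v i \o ffun_pr i)%VF).
split; [exact: qU|exact: qV|]; rewrite -uv; apply/lfunP=> x.
rewrite comp_lfunE !sum_lfunE; apply: eq_bigr => j _; rewrite !comp_lfunE.
congr (v j _); rewrite linear_sum (bigD1 j) //= comp_lfunE ffun_pr_inj eqxx.
rewrite big1 ?addr0 // => i ij.
by rewrite comp_lfunE ffun_pr_inj eq_sym (negbTE ij).
Qed.

End FfunMaps.

(** * Direct summands of powers of a bimodule *)

Section BimodSummand.

Variables (k : fieldType) (B A : fdAlgType k).
Implicit Types M N : bimod B A.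

(** The projection along a stable complement is a homomorphism; conversely,
    the image of a section is complemented by the kernel of its retraction. *)
Lemma bimod_summand_retract M N :
  bimod_summand M N <->
  (exists (i : 'Hom(M, N)) (r : 'Hom(N, M)),
     [/\ bimod_hom i, bimod_hom r & (r \o i = \1)%VF]).
Proof.
split.
  case=> P [Q] [PN] [QN PQT PQ0 [phi [[phi' phiK phi'K] [phil phir]]]].
  have psiE y : (phi^-1)%VF y = phi' y.
    apply: (can_inj phiK); rewrite phi'K lfun_surj_invK // => w.
    by exists (phi' w); rewrite phi'K.
  have pl b y : sub_proj P Q (lact b y) = @lact _ _ _ (sub_bimod PN) b (sub_proj P Q y).
    apply: val_inj; rewrite [RHS](vsval_sub_lact PN).
    move: y; apply: (split_ind PQT) => [y yP|y yQ|y y' /= IH IH'].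
    - by rewrite /= !(sub_proj_id PQ0) //; apply: PN.1.
    - rewrite /= !(sub_proj0 PQ0) //; last by apply: QN.1.
      by rewrite linear0 (bilin0r (lact_bilin _)).
    by rewrite (bilinDr (lact_bilin _)) !linearD /= IH IH' (bilinDr (lact_bilin _)).
  have pr b y : sub_proj P Q (ract y b) = @ract _ _ _ (sub_bimod PN) (sub_proj P Q y) b.
    apply: val_inj; rewrite [RHS](vsval_sub_ract PN).
    move: y; apply: (split_ind PQT) => [y yP|y yQ|y y' /= IH IH'].
    - by rewrite /= !(sub_proj_id PQ0) //; apply: PN.2.
    - rewrite /= !(sub_proj0 PQ0) //; last by apply: QN.2.
      by rewrite linear0 (bilin0l (ract_bilin _)).
    by rewrite (bilinDl (ract_bilin _)) !linearD /= IH IH' (bilinDl (ract_bilin _)).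
  exists (sub_incl P \o phi)%VF, (phi^-1 \o sub_proj P Q)%VF; split.
  - split=> [b m|m a]; rewrite !comp_lfunE !sub_inclE ?phil ?phir.
      exact: vsval_sub_lact.
    exact: vsval_sub_ract.
  - have rE y : (phi^-1 \o sub_proj P Q)%VF y = phi' (sub_proj P Q y).
      by rewrite comp_lfunE psiE.
    split=> [b m|m a]; rewrite !rE; apply: (can_inj phiK).
      by rewrite phi'K phil phi'K; apply: pl.
    by rewrite phi'K phir phi'K; apply: pr.
  rewrite -comp_lfunA (comp_lfunA (sub_proj P Q)) (sub_proj_incl PQ0) comp_lfun1l.
  by apply/lfunP=> m; rewrite comp_lfunE psiE phiK id_lfunE.
case=> i [r [[il ir] [rl rr] ri]].
have PN : @bimod_stable _ _ _ N (limg i).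
  by split=> [b _ /memv_imgP[m _ ->]|_ a /memv_imgP[m _ ->]];
    rewrite -?il -?ir memv_img ?memvf.
exists (limg i), (lker r), PN; split; last first.
- exists (retract_iso i); split; first exact: retract_iso_bij ri.
  split=> [b m|m a]; apply: val_inj.
    by rewrite /= (vsval_sub_lact PN) !retract_isoE il.
  by rewrite /= (vsval_sub_ract PN) !retract_isoE ir.
- exact: retract_cap.
- exact: retract_add.
split=> [b m|m a]; rewrite !memv_ker ?rl ?rr => /eqP ->.
  by rewrite (bilin0r (lact_bilin _)).
by rewrite (bilin0l (ract_bilin _)).
Qed.

Lemma bimod_summand_powP M N n :
  bimod_summand M (pow_bimod N n) <->
  (exists (u : 'I_n -> 'Hom(M, N)) (v : 'I_n -> 'Hom(N, M)),
     [/\ forall i, bimod_hom (u i), forall i, bimod_hom (v i)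
       & \sum_i (v i \o u i)%VF = \1%VF]).
Proof.
apply: (iff_trans (bimod_summand_retract _ _)); apply: ffun_retractP => [j phi|j phi|u|v].
- case=> hl hr; split=> [b m|m a]; rewrite !comp_lfunE !ffun_prE ?hl ?hr;
  exact: ffunE.
- case=> hl hr; split=> [b m|m a]; rewrite !comp_lfunE !ffun_injE -?hl -?hr;
    congr (phi _); apply/ffunP=> l; rewrite !ffunE; case: eqP => // _.
    by rewrite (bilin0r (lact_bilin _)).
  by rewrite (bilin0l (ract_bilin _)).
- move=> h; split=> [b m|m a]; apply/ffunP=> j; rewrite !ffunE !sum_lfunE !sum_ffunE.
    rewrite (big_morph _ (bilinDr (lact_bilin N) b) (bilin0r (lact_bilin N) b)).
    apply: eq_bigr => l _; rewrite !comp_lfunE !ffun_injE !ffunE (h l).1.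
    by case: eqP => //; rewrite (bilin0r (lact_bilin _)).
  rewrite (bilin_suml (ract_bilin N)).
  apply: eq_bigr => l _; rewrite !comp_lfunE !ffun_injE !ffunE (h l).2.
  by case: eqP => //; rewrite (bilin0l (ract_bilin _)).
move=> h; split=> [b m|m a]; rewrite !sum_lfunE.
  rewrite (bilin_sumr (lact_bilin M)).
  by apply: eq_bigr => l _; rewrite !comp_lfunE !ffun_prE ffunE (h l).1.
rewrite (bilin_suml (ract_bilin M)).
by apply: eq_bigr => l _; rewrite !comp_lfunE !ffun_prE ffunE (h l).2.
Qed.

End BimodSummand.

(** * Direct summands of powers of a bicomodule *)

Section BicomodSummand.

Variables (k : fieldType) (D E : coalgType k).
Implicit Types L M N : bicomod D E.

Lemma bicomod_homP M N (phi : 'Hom(M, N)) :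
  bicomod_hom phi <->
  (forall m, tmap \1 phi (lco M m) = lco N (phi m)) /\
  (forall m, tmap phi \1 (rco M m) = rco N (phi m)).
Proof.
split=> [[hl hr]|[hl hr]]; split.
- by move=> m; rewrite -comp_lfunE hl comp_lfunE.
- by move=> m; rewrite -comp_lfunE hr comp_lfunE.
- by apply/lfunP=> m; rewrite !comp_lfunE hl.
by apply/lfunP=> m; rewrite !comp_lfunE hr.
Qed.

Lemma bicomod_hom_comp L M N (phi : 'Hom(L, M)) (psi : 'Hom(M, N)) :
  bicomod_hom phi -> bicomod_hom psi -> bicomod_hom (psi \o phi)%VF.
Proof.
move=> /bicomod_homP[hl hr] /bicomod_homP[hl' hr']; apply/bicomod_homP.
split=> m; rewrite [in RHS]comp_lfunE.
  by rewrite (tmap_splitr _ phi psi) hl hl'.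
by rewrite (tmap_splitl phi psi) hr hr'.
Qed.

Lemma bicomod_hom_sum (I : finType) M N (phi : I -> 'Hom(M, N)) :
  (forall i, bicomod_hom (phi i)) -> bicomod_hom (\sum_i phi i).
Proof.
move=> h; apply/bicomod_homP; split=> m; rewrite sum_lfunE linear_sum.
  rewrite (bilin_sumr (tmap_bilin _ _ _ _)) sum_lfunE.
  by apply: eq_bigr => i _; have /bicomod_homP[hl _] := h i; rewrite hl.
rewrite (bilin_suml (tmap_bilin _ _ _ _)) sum_lfunE.
by apply: eq_bigr => i _; have /bicomod_homP[_ hr] := h i; rewrite hr.
Qed.

(** Homomorphisms can be tested after composition with a jointly split family
    of homomorphisms, because tensoring with D or E keeps such a family
    jointly injective. *)
Lemma bicomod_hom_jsplit (I : finType) L M N (j : I -> 'Hom(M, N))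
    (psi : 'Hom(L, M)) :
  jsplit j -> (forall i, bicomod_hom (j i)) ->
  (forall i, bicomod_hom (j i \o psi)%VF) -> bicomod_hom psi.
Proof.
move=> jP jh jpsi; apply/bicomod_homP; split=> x.
  apply: (jsplit_inj (jsplitl D jP)) => i.
  have [/bicomod_homP[hl _] /bicomod_homP[hl' _]] := (jh i, jpsi i).
  by rewrite hl -(tmap_splitr _ psi) hl' comp_lfunE.
apply: (jsplit_inj (jsplitr E jP)) => i.
have [/bicomod_homP[_ hr] /bicomod_homP[_ hr']] := (jh i, jpsi i).
by rewrite hr -(tmap_splitl psi) hr' comp_lfunE.
Qed.

Lemma bicomod_hom_id M : bicomod_hom (\1%VF : 'End(M)).
Proof. by apply/bicomod_homP; split=> m; rewrite tmap_id !id_lfunE. Qed.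

Lemma bicomod_hom0 M N : bicomod_hom (0 : 'Hom(M, N)).
Proof.
apply/bicomod_homP; split=> m; rewrite zero_lfunE linear0.
  by rewrite (bilin0r (tmap_bilin _ _ _ _)) zero_lfunE.
by rewrite (bilin0l (tmap_bilin _ _ _ _)) zero_lfunE.
Qed.

Lemma bicomod_hom_ffun_pr N n (i : 'I_n) :
  @bicomod_hom _ _ _ (pow_bicomod N n) N (ffun_pr N i).
Proof. by split; [exact: pow_lcoE|exact: pow_rcoE]. Qed.

Lemma bicomod_hom_ffun_inj N n (i : 'I_n) :
  @bicomod_hom _ _ _ N (pow_bicomod N n) (ffun_inj N i).
Proof.
have := @bicomod_hom_jsplit _ N (pow_bicomod N n) N (pow_pr N (n := n)) _ (pow_split N n).
apply=> j; first exact: bicomod_hom_ffun_pr.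
have -> : (pow_pr N j \o ffun_inj N i = if j == i then \1 else 0)%VF.
  apply/lfunP=> m; rewrite comp_lfunE; apply: (etrans (ffun_pr_inj j i m)).
  by case: eqP; rewrite ?id_lfunE ?zero_lfunE.
by case: eqP => _; [exact: bicomod_hom_id|exact: bicomod_hom0].
Qed.

Lemma bicomod_hom_incl N (P : {vspace N}) (PN : bicomod_stable P) :
  @bicomod_hom _ _ _ (sub_bicomod PN) N (sub_incl P).
Proof. by split; [exact: (sub_lcoE PN ord0)|exact: (sub_rcoE PN ord0)]. Qed.

(** On the image of i the map p inverts a homomorphism, and on the
    stable subspace Q it vanishes together with its effect on the coactions. *)
Lemma bicomod_hom_retraction L N (i : 'Hom(L, N)) (p : 'Hom(N, L))
    (Q : {vspace N}) :
  bicomod_hom i -> bicomod_stable Q -> (p \o i = \1)%VF ->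
  (forall q, q \in Q -> p q = 0) -> (limg i + Q = fullv)%VS ->
  bicomod_hom p.
Proof.
move=> /bicomod_homP[il ir] QN pi pQ0 iQT.
have pQ : (p \o linfun (@vsval _ _ Q) = 0)%VF.
  by apply/lfunP=> q; rewrite comp_lfunE zero_lfunE lfunE /= pQ0 ?subvsP.
apply/bicomod_homP; split; apply: (split_ind iQT).
- move=> _ /memv_imgP[u _ ->]; rewrite -il tmap_compE comp_lfun1l pi.
  by rewrite tmap_id id_lfunE (retractK pi).
- move=> y yQ; rewrite pQ0 // linear0.
  have /memv_imgP[t _ ->] := subvP QN.1 _ (memv_img (lco N) yQ).
  by rewrite tmap_compE pQ (bilin0r (tmap_bilin _ _ _ _)) zero_lfunE.
- by move=> y y' /= IH IH'; rewrite !linearD /= IH IH'.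
- move=> _ /memv_imgP[u _ ->]; rewrite -ir tmap_compE comp_lfun1l pi.
  by rewrite tmap_id id_lfunE (retractK pi).
- move=> y yQ; rewrite pQ0 // linear0.
  have /memv_imgP[t _ ->] := subvP QN.2 _ (memv_img (rco N) yQ).
  by rewrite tmap_compE pQ (bilin0l (tmap_bilin _ _ _ _)) zero_lfunE.
by move=> y y' /= IH IH'; rewrite !linearD /= IH IH'.
Qed.

Lemma bicomod_hom_proj N (P Q : {vspace N}) (PN : bicomod_stable P) :
  bicomod_stable Q -> (P + Q = fullv)%VS -> (P :&: Q = 0)%VS ->
  @bicomod_hom _ _ _ N (sub_bicomod PN) (sub_proj P Q).
Proof.
move=> QN PQT PQ0.
apply: (bicomod_hom_retraction (bicomod_hom_incl PN) QN (sub_proj_incl PQ0)).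
  by move=> q; apply: sub_proj0.
rewrite -PQT; congr (_ + _)%VS; apply/eqP; rewrite eqEsubv; apply/andP; split.
  by apply/subvP=> _ /memv_imgP[u _ ->]; rewrite sub_inclE; apply: subvsP.
apply/subvP=> y yP; apply/memv_imgP; exists (Subvs yP); first exact: memvf.
by rewrite sub_inclE.
Qed.

Lemma bicomod_hom_mono L M N (i : 'Hom(M, N)) (r : 'Hom(N, M))
    (psi : 'Hom(L, M)) (chi : 'Hom(L, N)) :
  (r \o i = \1)%VF -> bicomod_hom i -> (i \o psi)%VF = chi ->
  bicomod_hom chi -> bicomod_hom psi.
Proof.
move=> ri ih <- ipsi; have iP : jsplit (fun _ : 'I_1 => i).
  by exists (fun=> r); rewrite big_ord1.
exact: (bicomod_hom_jsplit iP).
Qed.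

Lemma bicomod_summand_retract M N :
  bicomod_summand M N <->
  (exists (i : 'Hom(M, N)) (r : 'Hom(N, M)),
     [/\ bicomod_hom i, bicomod_hom r & (r \o i = \1)%VF]).
Proof.
split.
  case=> P [Q] [PN] [QN PQT PQ0 [phi [[phi' phiK phi'K] phi_hom]]].
  have phi_invK : cancel (phi^-1)%VF phi.
    by apply: lfun_surj_invK => y; exists (phi' y); rewrite phi'K.
  have invK : (phi \o phi^-1 = \1)%VF.
    by apply/lfunP=> w; rewrite comp_lfunE id_lfunE phi_invK.
  have phiV : (phi^-1 \o phi = \1)%VF.
    apply/lfunP=> m; rewrite comp_lfunE id_lfunE; apply: (can_inj phiK).
    by rewrite phi_invK.
  have inv_hom : @bicomod_hom _ _ _ (sub_bicomod PN) M (phi^-1)%VF.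
    exact: (bicomod_hom_mono phiV phi_hom invK (bicomod_hom_id _)).
  exists (sub_incl P \o phi)%VF, (phi^-1 \o sub_proj P Q)%VF; split.
  - exact: bicomod_hom_comp phi_hom (bicomod_hom_incl PN).
  - exact: bicomod_hom_comp (bicomod_hom_proj PN QN PQT PQ0) inv_hom.
  rewrite -comp_lfunA (comp_lfunA (sub_proj P Q)) (sub_proj_incl PQ0).
  by rewrite comp_lfun1l.
case=> i [r [ih /bicomod_homP[rl rr] ri]].
have vpi : (sub_incl (limg i) \o retract_iso i = i)%VF.
  by apply/lfunP=> m; rewrite comp_lfunE sub_inclE; apply: retract_isoE.
have /bicomod_homP[il ir] := ih.
have PN : @bicomod_stable _ _ _ N (limg i).
  split; apply/subvP=> _ /memv_imgP[_ /memv_imgP[m _ ->] ->].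
    rewrite -il -[X in tmap _ X _]vpi (tmap_splitr _ (retract_iso i)).
    exact: memv_img (memvf _).
  rewrite -ir -[X in tmap X _ _]vpi (tmap_splitl (retract_iso i)).
  exact: memv_img (memvf _).
exists (limg i), (lker r), PN; split; last first.
- exists (retract_iso i); split; first exact: retract_iso_bij ri.
  have viK : (linfun (vsproj (limg i)) \o sub_incl (limg i) = \1)%VF.
    by apply/lfunP=> u; rewrite comp_lfunE sub_inclE lfunE id_lfunE; apply: vsvalK.
  exact: (@bicomod_hom_mono M (sub_bicomod PN) N _ _ _ _
           viK (bicomod_hom_incl PN) vpi ih).
- exact: retract_cap.
- exact: retract_add.
split; apply/subvP=> _ /memv_imgP[x + ->]; rewrite memv_ker => /eqP rx.
  by apply: tens_lkerl; rewrite rl rx linear0.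
by apply: tens_lkerr; rewrite rr rx linear0.
Qed.

Lemma bicomod_summand_powP M N n :
  bicomod_summand M (pow_bicomod N n) <->
  (exists (u : 'I_n -> 'Hom(M, N)) (v : 'I_n -> 'Hom(N, M)),
     [/\ forall i, bicomod_hom (u i), forall i, bicomod_hom (v i)
       & \sum_i (v i \o u i)%VF = \1%VF]).
Proof.
apply: (iff_trans (bicomod_summand_retract _ _)).
apply: ffun_retractP => [j phi h|j phi h|u h|v h].
- exact: bicomod_hom_comp h (bicomod_hom_ffun_pr N j).
- exact: bicomod_hom_comp (bicomod_hom_ffun_inj N j) h.
- apply: bicomod_hom_sum => i.
  exact: bicomod_hom_comp (h i) (bicomod_hom_ffun_inj N i).
apply: bicomod_hom_sum => i.
exact: bicomod_hom_comp (bicomod_hom_ffun_pr N i) (h i).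
Qed.

End BicomodSummand.

(** * Codepth two is dual to depth two *)

Section DualSummand.

Variables (k : fieldType) (D E : coalgType k) (M N : bicomod D E).
Variables (M' N' : bimod (dual D) (dual E)).
Variables (p : 'Hom(M', 'Hom(M, k^o))) (q : 'Hom(N', 'Hom(N, k^o))).

(** The families that split M off a power of N transpose, with their roles
    exchanged, to families that split M' off a power of N'. *)
Lemma dual_summand_pow n : dual_pair p -> dual_pair q ->
  bicomod_summand M (pow_bicomod N n) <-> bimod_summand M' (pow_bimod N' n).
Proof.
move=> pP qP; have [pp qp] := (dp_perfect pP, dp_perfect qP).
split=> [/bicomod_summand_powP|/bimod_summand_powP] [u [v [uh vh uv]]];
  [apply/bimod_summand_powP|apply/bicomod_summand_powP].
  have au i := transpP q (u i) pp; have av i := transpP p (v i) qp.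
  exists (fun i => transp q p (v i)), (fun i => transp p q (u i)); split.
  - by move=> i; apply/(adjoint_hom qP pP (av i)).
  - by move=> i; apply/(adjoint_hom pP qP (au i)).
  by apply/(adjoint_retract pp au av).
have au i := transp_flipP q (u i) pp; have av i := transp_flipP p (v i) qp.
exists (fun i => transp (lflip q) (lflip p) (v i)),
       (fun i => transp (lflip p) (lflip q) (u i)); split.
- by move=> i; apply/(adjoint_hom pP qP (av i)).
- by move=> i; apply/(adjoint_hom qP pP (au i)).
by apply/(adjoint_retract pp av au).
Qed.

End DualSummand.

Section CodepthDepth.

Variables (k : fieldType) (C D : coalgType k) (g : coalgHom C D).

Let dg (d : dual D) : dual_hom g d = (d \o g)%VF.
Proof. exact: dual_mapE. Qed.

Let di (d : dual C) : alg_id (dual C) d = (d \o coalg_id C)%VF.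
Proof. by rewrite /= id_lfunE comp_lfun1r. Qed.

Lemma left_codepth_depth :
  left_codepth_two g <-> left_depth_two (dual_hom g).
Proof.
have p2 := corestr_dual_pair dg di.
have pt := cotens_dual_pair (corestr_dual_pair dg dg) p2.
by split=> -[n n0 h]; exists n => //; apply/(dual_summand_pow n pt p2).
Qed.

Lemma right_codepth_depth :
  right_codepth_two g <-> right_depth_two (dual_hom g).
Proof.
have p2 := corestr_dual_pair di dg.
have pt := cotens_dual_pair p2 (corestr_dual_pair dg dg).
by split=> -[n n0 h]; exists n => //; apply/(dual_summand_pow n pt p2).
Qed.

End CodepthDepth.

(** * Maps out of tensor products over an algebra *)

Section RelativeTensor.

Variables (k : fieldType) (M L N U W : vectType k).
Variables (ra : M -> L -> M) (la : L -> N -> N).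

Lemma rtens_ind (P : rtens ra la -> Prop) :
  (forall m n, P (rtmul ra la m n)) -> (forall x y, P x -> P y -> P (x + y)) ->
  forall t, P t.
Proof.
move=> Pm PD t; rewrite -(quo_reprK t); elim/tens_ind: (quo_repr _ t) => [m n|x y].
  exact: Pm.
by rewrite linearD; apply: PD.
Qed.

Lemma rlift_eq (h h' : M -> N -> U) t : h =2 h' -> rlift ra la h t = rlift ra la h' t.
Proof. by move=> hh'; rewrite !comp_lfunE (tlift_eq hh'). Qed.

Lemma rliftD (h h' : M -> N -> U) t :
  rlift ra la (fun m n => h m n + h' m n) t = rlift ra la h t + rlift ra la h' t.
Proof.
rewrite !comp_lfunE -add_lfunE -[tlift h]scale1r -tlift_linear.
by congr (fun_of_lfun _ _); apply: tlift_eq => m n; rewrite scale1r.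
Qed.

Lemma rlift0 (h : M -> N -> U) t : (forall m n, h m n = 0) -> rlift ra la h t = 0.
Proof.
move=> h0; rewrite comp_lfunE tlift_def big1 // => i _.
by rewrite big1 // => j _; rewrite h0 scaler0.
Qed.

Lemma rlift_comp (h : M -> N -> U) (l : U -> W) t : linear l ->
  rlift ra la (fun m n => l (h m n)) t = l (rlift ra la h t).
Proof.
move=> lL; rewrite -(linfunE lL) !comp_lfunE !tlift_def linear_sum.
apply: eq_bigr => i _; rewrite linear_sum; apply: eq_bigr => j _.
by rewrite linearZ /= (linfunE lL).
Qed.

End RelativeTensor.

Section BimoduleTensor.

Variables (k : fieldType) (B' B A' : fdAlgType k).
Variables (M : bimod B' B) (N : bimod B A').

Definition btens (m : M) (n : N) : rtens_bimod M N :=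
  rtmul (@ract _ _ _ M) (@lact _ _ _ N) m n.

Definition blift (U : vectType k) (h : M -> N -> U) :
  'Hom(rtens_bimod M N, U) := rlift (@ract _ _ _ M) (@lact _ _ _ N) h.

Lemma btens_bilin : bilin btens.
Proof. exact: rtmul_bilin. Qed.

Lemma btens_bal m b n : btens (ract m b) n = btens m (lact b n).
Proof. exact: (rtmul_bal (ract_bilin M) (lact_bilin N)). Qed.

Lemma lact_btens b m n : lact b (btens m n) = btens (lact b m) n.
Proof.
apply: etrans (quo_lact_pi (bal_rel_stable M N) b (m \ox n)) _.
by rewrite /= tens_lactE.
Qed.

Lemma ract_btens m n a : ract (btens m n) a = btens m (ract n a).
Proof.
apply: etrans (quo_ract_pi (bal_rel_stable M N) (m \ox n) a) _.
by rewrite /= tens_ractE.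
Qed.

Lemma btens_ind (P : rtens_bimod M N -> Prop) :
  (forall m n, P (btens m n)) -> (forall x y, P x -> P y -> P (x + y)) ->
  forall t, P t.
Proof. exact: rtens_ind. Qed.

Variable U : vectType k.
Variable h : M -> N -> U.
Hypothesis hP : bilin h.
Hypothesis hbal : forall m b n, h (ract m b) n = h m (lact b n).

Lemma bliftE m n : blift h (btens m n) = h m n.
Proof. by apply: (rliftE (ract_bilin M) (lact_bilin N)). Qed.

(** Acting on the argument amounts to acting on the first factor inside the
    lifted map: this turns the commutation of an element of a tensor product
    with B into an identity between the values of lifted maps. *)
Lemma blift_lact b t : blift h (lact b t) = blift (fun m n => h (lact b m) n) t.
Proof.
have h'P : bilin (fun m n => h (lact b m) n).
  apply: bilinP => [a x y z|a x y z]; last exact: (proj2 hP).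
  by rewrite (proj2 (lact_bilin _)) (proj1 hP).
elim/btens_ind: t => [m n|x y IHx IHy]; last first.
  by rewrite (bilinDr (lact_bilin _)) !linearD /= IHx IHy.
rewrite lact_btens bliftE; apply/esym.
apply: (rliftE (ract_bilin M) (lact_bilin N) m n h'P) => x c y.
by rewrite -lractA hbal.
Qed.

Lemma blift_ract t a : blift h (ract t a) = blift (fun m n => h m (ract n a)) t.
Proof.
have h'P : bilin (fun m n => h m (ract n a)).
  apply: bilinP => [c x y z|c x y z]; first exact: (proj1 hP).
  by rewrite (proj1 (ract_bilin _)) (proj2 hP).
elim/btens_ind: t => [m n|x y IHx IHy]; last first.
  by rewrite (bilinDl (ract_bilin _)) !linearD /= IHx IHy.
rewrite ract_btens bliftE; apply/esym.
apply: (rliftE (ract_bilin M) (lact_bilin N) m n h'P) => x c y.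
by rewrite lractA hbal.
Qed.

End BimoduleTensor.

(** * The coproduct of End(_B A_B) *)

Section Coproduct.

Variables (k : fieldType) (B A : fdAlgType k) (f : algHom B A).
Local Notation S := (lend f).
Local Notation S2 := (lend2 f).
Local Notation R := (subvs_of (centralizer f)).
Local Notation stens := (rtmul (@lend_ract _ _ _ f) (@lend_lact _ _ _ f)).
Local Notation eval := (@lend2_eval _ _ _ f).
Local Notation lfn := (@lend_fun _ _ _ f).

Let mb : bilin (@amul k A) := amul_bilin (s := A).
Let mDl := bilinDl mb.
Let mDr := bilinDr mb.
Let mZl := bilinZl mb.
Let mZr := bilinZr mb.

Lemma lend_funD (a b : S) x : lfn (a + b) x = lfn a x + lfn b x.
Proof. by rewrite /lend_fun linearD add_lfunE. Qed.

Lemma lend_funP a (u v : S) x : lfn (a *: u + v) x = a *: lfn u x + lfn v x.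
Proof. by rewrite /lend_fun linearP add_lfunE scale_lfunE. Qed.

Lemma lend_fun0 x : lfn 0 x = 0.
Proof. by apply: (addIr (lfn 0 x)); rewrite -lend_funD !add0r. Qed.

Lemma lend_fun_sum n (a : 'I_n -> S) x :
  lfn (\sum_i a i) x = \sum_i lfn (a i) x.
Proof. by rewrite /lend_fun linear_sum sum_lfunE. Qed.

Lemma lend_ext (a b : S) : (forall x, lfn a x = lfn b x) -> a = b.
Proof. by move=> ab; apply: val_inj; apply/lfunP. Qed.

Lemma lend2_evalD (t t' : S2) x y : eval (t + t') x y = eval t x y + eval t' x y.
Proof. exact: linearD. Qed.

Lemma stens_bilin : bilin stens.
Proof. exact: rtmul_bilin. Qed.

Lemma stens_bal (a : S) (r : R) (b : S) :
  stens (lend_ract a r) b = stens a (lend_lact r b).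
Proof. exact: (rtmul_bal (@lend_ract_bilin _ _ _ f) (@lend_lact_bilin _ _ _ f)). Qed.

Lemma lend_lactE (r : R) (a : S) x : lfn (lend_lact r a) x = vsval r ** lfn a x.
Proof. by rewrite {1}/lend_fun /= comp_lfunE lmulE. Qed.

Lemma lend_ractE (r : R) (a : S) x : lfn (lend_ract a r) x = lfn a x ** vsval r.
Proof. by rewrite {1}/lend_fun /= comp_lfunE rmulE. Qed.

Lemma lend2_eval_bilin (t : S2) : bilin (eval t).
Proof.
apply: bilinP => [c x y z|c x y z]; elim/rtens_ind: t => [a b|t t' IH IH'].
- by rewrite !lend2_evalE linearP mDl mZl.
- by rewrite !lend2_evalD IH IH' addrACA scalerDr.
- by rewrite !lend2_evalE linearP mDr mZr.
by rewrite !lend2_evalD IH IH' addrACA scalerDr.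
Qed.

(** The coproduct is ev^-1 (alpha \o multiplication), where ev sends an element
    of S (x)_R S to the map that it induces on A (x) A. *)
Lemma lend_comul_exists :
  (forall t : S2, (forall x y, eval t x y = 0) -> t = 0) ->
  (forall alpha : S, exists t : S2, forall x y, eval t x y = lfn alpha (x ** y)) ->
  exists DS, @is_lend_comul _ _ _ f DS.
Proof.
move=> inj sur.
pose ev : 'Hom(S2, 'Hom(tens A A, A)) := linfun (fun t => tlift (eval t)).
have evE t x y : ev t (x \ox y) = eval t x y.
  rewrite /ev linfunE => [|a s s']; first exact: (tliftE _ _ (lend2_eval_bilin t)).
  rewrite -tlift_linear; apply: tlift_eq => p q.
  exact: linearP.
pose cm : 'Hom(S, 'Hom(tens A A, A)) :=
  linfun (fun alpha : S => (lfn alpha \o tlift (@amul k A))%VF).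
have cmE alpha x y : cm alpha (x \ox y) = lfn alpha (x ** y).
  rewrite /cm linfunE; first by rewrite comp_lfunE tliftE.
  by move=> a s s'; apply/lfunP=> z; rewrite add_lfunE scale_lfunE !comp_lfunE lend_funP.
exists (ev^-1 \o cm)%VF => alpha t.
have evDS : ev ((ev^-1 \o cm)%VF alpha) = cm alpha.
  rewrite comp_lfunE; apply: limg_lfunVK.
  have [s sE] := sur alpha; suff -> : cm alpha = ev s by rewrite memv_img ?memvf.
  by apply: tens_ext => x y; rewrite evE sE cmE.
split=> [-> x y|tE]; first by rewrite -evE evDS cmE.
apply/eqP; rewrite -subr_eq0; apply/eqP; apply: inj => x y.
by rewrite -evE linearB /= evDS add_lfunE opp_lfunE evE cmE tE subrr.
Qed.

Lemma amul_map_bilinl (h : A -> A) : linear h -> bilin (fun a b : A => h a ** b).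
Proof.
move=> hL; apply: bilinP => [a x y z|a x y z]; last by rewrite mDr mZr.
by rewrite hL mDl mZl.
Qed.

Lemma amul_map_bilinr (h : A -> A) : linear h -> bilin (fun a b : A => a ** h b).
Proof.
move=> hL; apply: bilinP => [a x y z|a x y z]; first by rewrite mDl mZl.
by rewrite hL mDr mZr.
Qed.

Section Left.

Local Notation T := (rtens_bimod (restr f f) (restr f (alg_id A))).
Local Notation bt := (@btens _ _ _ _ (restr f f) (restr f (alg_id A))).
Local Notation bl := (@blift _ _ _ _ (restr f f) (restr f (alg_id A)) A).

(** For homomorphisms u_i and v_i splitting A (x)_B A off A^n as a
    B-A-bimodule, take beta_i(x) = u_i(x (x) 1) and t_i = v_i(1). *)
Lemma left_depth_two_quasibasis : left_depth_two f ->
  exists n (t : 'I_n -> T) (beta : 'I_n -> S),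
    (forall i b, lact b (t i) = ract (t i) (f b)) /\
    (forall x, bt x aone = \sum_i ract (t i) (lfn (beta i) x)).
Proof.
case=> n _ /bimod_summand_powP[u [v [uh vh uv]]].
have beta_mem i : (linfun (fun x : A => u i (bt x aone)) : 'End(restr f f))
    \in bimod_end (restr f f).
  have bL : linear (fun x : A => u i (bt x aone) : A).
    move=> a x y; rewrite (proj1 (btens_bilin _ _)); exact: linearP.
  apply: (lend_mem (f := f)) => [b x|x b]; rewrite !(linfunE bL).
    by rewrite -[f b ** x]/(lact (b := restr f f) b x) -lact_btens (uh i).1.
  rewrite -[x ** f b]/(ract (b := restr f f) x b) btens_bal.
  rewrite /= /restr_lact amul1r.
  have -> : bt x (f b) = ract (bt x aone) (f b).
    by rewrite ract_btens /= /restr_ract amul1l /= id_lfunE.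
  by rewrite (uh i).2 /= /restr_ract /= id_lfunE.
exists n, (fun i => v i (aone : A)), (fun i => Subvs (beta_mem i)); split.
  move=> i b; rewrite -(vh i).1 -(vh i).2 /= /restr_lact /restr_ract /=.
  by rewrite id_lfunE amul1l amul1r.
move=> x; rewrite -[LHS]id_lfunE -uv sum_lfunE; apply: eq_bigr => i _.
rewrite comp_lfunE -(vh i).2 /= /restr_ract /= id_lfunE amul1l; congr (v i _).
rewrite /lend_fun /= linfunE // => a y z.
by rewrite (proj1 (btens_bilin _ _)); apply: linearP.
Qed.

Variables (n : nat) (t : 'I_n -> T) (beta : 'I_n -> S).
Hypothesis tB : forall i b, lact b (t i) = ract (t i) (f b).
Hypothesis tbeta : forall x, bt x aone = \sum_i ract (t i) (lfn (beta i) x).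

Section Lift.

Variable h : A -> A.
Hypotheses (hL : linear h) (hr : forall x b, h (x ** f b) = h x ** f b).

Let hP : @bilin k (restr f f) (restr f (alg_id A)) A (fun x y => h x ** y) :=
  amul_map_bilinl hL.

Let hbal (m : restr f f) b (m' : restr f (alg_id A)) :
  h (ract m b) ** m' = h m ** (lact b m').
Proof. by rewrite /= /restr_ract hr -amulA. Qed.

Lemma left_lift_ract s a : bl (fun x y => h x ** y) (ract s a) =
  bl (fun x y => h x ** y) s ** a.
Proof.
rewrite (blift_ract hP hbal).
apply: etrans _ (rlift_comp _ _ (l := fun z => z ** a) (proj1 mb a)).
by apply: rlift_eq => x y; rewrite /= /restr_ract /= id_lfunE amulA.
Qed.

Lemma left_lift_lact s b : bl (fun x y => h x ** y) (lact b s) =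
  bl (fun x y => h (f b ** x) ** y) s.
Proof. by rewrite (blift_lact hP hbal). Qed.

(** Apply the map x (x) y |-> h(x) y to the equation expressing x (x) 1 in the
    quasibasis. *)
Lemma left_reconstruct x :
  \sum_i bl (fun x y => h x ** y) (t i) ** lfn (beta i) x = h x.
Proof.
rewrite -[RHS]amul1r -[RHS](bliftE hP hbal) tbeta linear_sum.
by apply: eq_bigr => i _; rewrite /= left_lift_ract.
Qed.

End Lift.

Let lfnL (a : S) : linear (lfn a).
Proof. by move=> c x y; rewrite linearP. Qed.

(** delta(t_i^1) t_i^2 commutes with B because t_i does. *)
Let left_coefficient_mem (delta : S) i :
  bl (fun x y => lfn delta x ** y) (t i) \in centralizer f.
Proof.
have dr x b := (lendP delta).2 x b.
apply/centralizerP => b.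
rewrite -(left_lift_ract (lfnL delta) dr) -tB (left_lift_lact (lfnL delta) dr).
apply: etrans (esym (rlift_comp _ _ (l := amul (f b)) (proj2 mb (f b)))) _.
by apply: rlift_eq => x y; rewrite amulA (lendP delta).1.
Qed.

(** For s = gamma (x) delta, put r_i = delta(t_i^1) t_i^2, an element of R.
    Then delta = \sum_i r_i beta_i, and moving the r_i across the tensor sign
    gives s = \sum_i gamma r_i (x) beta_i, where
    gamma(x) r_i = s(x, t_i^1) t_i^2 depends on s only through the map
    that it induces. *)
Lemma left_lend2_decomposition (s : S2) :
  exists K : 'I_n -> S, s = \sum_i stens (K i) (beta i) /\
    (forall i x, lfn (K i) x = bl (fun y z => eval s x y ** z) (t i)).
Proof.
elim/rtens_ind: s => [gam delta|s s' [K [sE KE]] [K' [s'E K'E]]]; last first.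
  exists (fun i => K i + K' i); split=> [|i x].
    rewrite sE s'E -big_split; apply: eq_bigr => i _ /=.
    by rewrite (bilinDl stens_bilin).
  rewrite lend_funD KE K'E -rliftD; apply: rlift_eq => y z.
  by rewrite lend2_evalD mDl.
pose r i : R := Subvs (left_coefficient_mem delta i).
exists (fun i => lend_ract gam (r i)); split=> [|i x].
  under eq_bigr do rewrite stens_bal.
  rewrite -(bilin_sumr stens_bilin); congr (stens gam _); apply: lend_ext => x.
  rewrite lend_fun_sum -[LHS](left_reconstruct (lfnL delta)); last exact: (lendP delta).2.
  by apply: eq_bigr => i _; rewrite lend_lactE.
rewrite lend_ractE /=.
apply: etrans (esym (rlift_comp _ _ (l := amul (lfn gam x)) (proj2 mb _))) _.
by apply: rlift_eq => y z; rewrite lend2_evalE amulA.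
Qed.

Lemma left_lend2_eval_inj (s : S2) : (forall x y, eval s x y = 0) -> s = 0.
Proof.
move=> s0; have [K [sE KE]] := left_lend2_decomposition s; rewrite sE.
apply: big1 => i _; suff -> : K i = 0 by rewrite (bilin0l stens_bilin).
apply: lend_ext => x; rewrite KE lend_fun0; apply: rlift0 => y z.
by rewrite s0 (bilin0l mb).
Qed.

(** The coproduct of alpha is \sum_i alpha(- t_i^1) t_i^2 (x) beta_i. *)
Lemma left_lend2_eval_sur (alpha : S) :
  exists s : S2, forall x y, eval s x y = lfn alpha (x ** y).
Proof.
pose G i x := bl (fun y z => lfn alpha (x ** y) ** z) (t i).
have axL x : linear (fun y => lfn alpha (x ** y)).
  by move=> c y z; rewrite (proj2 mb) linearP.
have axr x y b : lfn alpha (x ** (y ** f b)) = lfn alpha (x ** y) ** f b.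
  by rewrite amulA (lendP alpha).2.
have GL i : linear (G i).
  move=> c x y; rewrite /G.
  have h0 : linear ( *:%R c : A -> A) by move=> d u v; rewrite scalerDr !scalerA mulrC.
  rewrite -(rlift_comp _ _ (l := *:%R c) h0) -rliftD; apply: rlift_eq => u v.
  by rewrite (proj1 mb) linearP mDl mZl.
have G_mem i : (linfun (G i) : 'End(restr f f)) \in bimod_end (restr f f).
  apply: (lend_mem (f := f)) => [b x|x b]; rewrite !(linfunE (GL i)) /G.
    apply: etrans _ (rlift_comp _ _ (l := amul (f b)) (proj2 mb _)).
    by apply: rlift_eq => y z; rewrite -amulA (lendP alpha).1 amulA.
  rewrite -(left_lift_ract (axL x) (axr x)) -tB (left_lift_lact (axL x) (axr x)).
  by apply: rlift_eq => y z; rewrite amulA.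
exists (\sum_i stens (Subvs (G_mem i)) (beta i)) => x y.
rewrite [LHS](_ : _ = \sum_i eval (stens (Subvs (G_mem i)) (beta i)) x y); last first.
  exact: linear_sum.
rewrite -(left_reconstruct (axL x) (axr x)); apply: eq_bigr => i _.
by rewrite lend2_evalE {1}/lend_fun /= (linfunE (GL i)).
Qed.

End Left.
Section Right.

Local Notation T := (rtens_bimod (restr (alg_id A) f) (restr f f)).
Local Notation bt := (@btens _ _ _ _ (restr (alg_id A) f) (restr f f)).
Local Notation bl := (@blift _ _ _ _ (restr (alg_id A) f) (restr f f) A).

(** For homomorphisms u_i and v_i splitting A (x)_B A off A^n as an
    A-B-bimodule, take gamma_i(x) = u_i(1 (x) x) and t_i = v_i(1). *)
Lemma right_depth_two_quasibasis : right_depth_two f ->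
  exists n (t : 'I_n -> T) (gamma : 'I_n -> S),
    (forall i b, lact (f b) (t i) = ract (t i) b) /\
    (forall x, bt aone x = \sum_i lact (lfn (gamma i) x) (t i)).
Proof.
case=> n _ /bimod_summand_powP[u [v [uh vh uv]]].
have uL i : linear (fun x : A => u i (bt aone x) : A).
  move=> a x y; rewrite (proj2 (btens_bilin _ _)); exact: linearP.
have gamma_mem i : (linfun (fun x : A => u i (bt aone x)) : 'End(restr f f))
    \in bimod_end (restr f f).
  apply: (lend_mem (f := f)) => [b x|x b]; rewrite !(linfunE (uL i)).
    rewrite -[f b ** x]/(lact (b := restr f f) b x) -btens_bal.
    rewrite /= /restr_ract amul1l.
    have -> : bt (f b) x = lact (f b) (bt aone x).
      by rewrite lact_btens /= /restr_lact amul1r /= id_lfunE.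
    by rewrite (uh i).1 /= /restr_lact /= id_lfunE.
  by rewrite -[x ** f b]/(ract (b := restr f f) x b) -ract_btens (uh i).2.
exists n, (fun i => v i (aone : A)), (fun i => Subvs (gamma_mem i)); split.
  move=> i b; rewrite -(vh i).1 -(vh i).2 /= /restr_lact /restr_ract /=.
  by rewrite id_lfunE amul1l amul1r.
move=> x; rewrite -[LHS]id_lfunE -uv sum_lfunE; apply: eq_bigr => i _.
rewrite comp_lfunE -(vh i).1 /= /restr_lact /= id_lfunE amul1r; congr (v i _).
by rewrite /lend_fun /= (linfunE (uL i)).
Qed.

Variables (n : nat) (t : 'I_n -> T) (gamma : 'I_n -> S).
Hypothesis tB : forall i b, lact (f b) (t i) = ract (t i) b.
Hypothesis tgamma : forall x, bt aone x = \sum_i lact (lfn (gamma i) x) (t i).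

Section Lift.

Variable h : A -> A.
Hypotheses (hL : linear h) (hl : forall b x, h (f b ** x) = f b ** h x).

Let hP : @bilin k (restr (alg_id A) f) (restr f f) A (fun x y => x ** h y) :=
  amul_map_bilinr hL.

Let hbal (m : restr (alg_id A) f) b (m' : restr f f) :
  ract m b ** h m' = m ** h (lact b m').
Proof. by rewrite /= /restr_lact hl amulA. Qed.

Lemma right_lift_lact s a : bl (fun x y => x ** h y) (lact a s) =
  a ** bl (fun x y => x ** h y) s.
Proof.
rewrite (blift_lact hP hbal).
apply: etrans _ (rlift_comp _ _ (l := amul a) (proj2 mb a)).
by apply: rlift_eq => x y; rewrite /= /restr_lact /= id_lfunE amulA.
Qed.

Lemma right_lift_ract s b : bl (fun x y => x ** h y) (ract s b) =
  bl (fun x y => x ** h (y ** f b)) s.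
Proof. by rewrite (blift_ract hP hbal). Qed.

Lemma right_reconstruct x :
  \sum_i lfn (gamma i) x ** bl (fun x y => x ** h y) (t i) = h x.
Proof.
rewrite -[RHS]amul1l -[RHS](bliftE hP hbal) tgamma linear_sum.
by apply: eq_bigr => i _; rewrite /= right_lift_lact.
Qed.

End Lift.

Let lfnL (a : S) : linear (lfn a).
Proof. by move=> c x y; rewrite linearP. Qed.

Let right_coefficient_mem (delta : S) i :
  bl (fun x y => x ** lfn delta y) (t i) \in centralizer f.
Proof.
have dl b x := (lendP delta).1 b x.
apply/centralizerP => b; apply/esym.
rewrite -(right_lift_lact (lfnL delta) dl) tB (right_lift_ract (lfnL delta) dl).
apply: etrans (esym (rlift_comp _ _ (l := fun z => z ** f b) (proj1 mb (f b)))) _.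
by apply: rlift_eq => x y; rewrite -amulA (lendP delta).2.
Qed.

(** For s = alpha (x) delta, here alpha = \sum_i gamma_i r_i with
    r_i = t_i^1 alpha(t_i^2), whence s = \sum_i gamma_i (x) r_i delta. *)
Lemma right_lend2_decomposition (s : S2) :
  exists K : 'I_n -> S, s = \sum_i stens (gamma i) (K i) /\
    (forall i y, lfn (K i) y = bl (fun z x => z ** eval s x y) (t i)).
Proof.
elim/rtens_ind: s => [gam delta|s s' [K [sE KE]] [K' [s'E K'E]]]; last first.
  exists (fun i => K i + K' i); split=> [|i x].
    rewrite sE s'E -big_split; apply: eq_bigr => i _ /=.
    by rewrite (bilinDr stens_bilin).
  rewrite lend_funD KE K'E -rliftD; apply: rlift_eq => y z.
  by rewrite lend2_evalD mDr.
pose r i : R := Subvs (right_coefficient_mem gam i).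
exists (fun i => lend_lact (r i) delta); split=> [|i x].
  under eq_bigr do rewrite -stens_bal.
  rewrite -(bilin_suml stens_bilin); congr (stens _ delta); apply: lend_ext => x.
  rewrite lend_fun_sum -[LHS](right_reconstruct (lfnL gam)); last exact: (lendP gam).1.
  by apply: eq_bigr => i _; rewrite lend_ractE.
rewrite lend_lactE /=.
apply: etrans (esym (rlift_comp _ _ (l := fun z => z ** lfn delta x) (proj1 mb _))) _.
by apply: rlift_eq => y z; rewrite lend2_evalE amulA.
Qed.

Lemma right_lend2_eval_inj (s : S2) : (forall x y, eval s x y = 0) -> s = 0.
Proof.
move=> s0; have [K [sE KE]] := right_lend2_decomposition s; rewrite sE.
apply: big1 => i _; suff -> : K i = 0 by rewrite (bilin0r stens_bilin).
apply: lend_ext => x; rewrite KE lend_fun0; apply: rlift0 => y z.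
by rewrite s0 (bilin0r mb).
Qed.

(** The coproduct of alpha is \sum_i gamma_i (x) t_i^1 alpha(t_i^2 -). *)
Lemma right_lend2_eval_sur (alpha : S) :
  exists s : S2, forall x y, eval s x y = lfn alpha (x ** y).
Proof.
pose G i y := bl (fun z x => z ** lfn alpha (x ** y)) (t i).
have ayL y : linear (fun x => lfn alpha (x ** y)).
  by move=> c x z; rewrite (proj1 mb) linearP.
have ayl y b x : lfn alpha ((f b ** x) ** y) = f b ** lfn alpha (x ** y).
  by rewrite -amulA (lendP alpha).1.
have GL i : linear (G i).
  move=> c x y; rewrite /G.
  have h0 : linear ( *:%R c : A -> A) by move=> d u v; rewrite scalerDr !scalerA mulrC.
  rewrite -(rlift_comp _ _ (l := *:%R c) h0) -rliftD; apply: rlift_eq => u v.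
  by rewrite (proj2 mb) linearP mDr mZr.
have G_mem i : (linfun (G i) : 'End(restr f f)) \in bimod_end (restr f f).
  apply: (lend_mem (f := f)) => [b y|y b]; rewrite !(linfunE (GL i)) /G.
    rewrite -(right_lift_lact (ayL y) (ayl y)) tB (right_lift_ract (ayL y) (ayl y)).
    by apply: rlift_eq => x z; rewrite amulA.
  apply: etrans _ (rlift_comp _ _ (l := fun z => z ** f b) (proj1 mb _)).
  by apply: rlift_eq => x z; rewrite amulA (lendP alpha).2 amulA.
exists (\sum_i stens (gamma i) (Subvs (G_mem i))) => x y.
rewrite [LHS](_ : _ = \sum_i eval (stens (gamma i) (Subvs (G_mem i))) x y); last first.
  exact: linear_sum.
rewrite -(right_reconstruct (ayL y) (ayl y)); apply: eq_bigr => i _.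
by rewrite lend2_evalE {2}/lend_fun /= (linfunE (GL i)).
Qed.

End Right.

Lemma depth_two_lend_comul : left_depth_two f \/ right_depth_two f ->
  exists DS, @is_lend_comul _ _ _ f DS.
Proof.
case=> [/left_depth_two_quasibasis|/right_depth_two_quasibasis] [n [t [b [tB tb]]]].
  exact: lend_comul_exists (left_lend2_eval_inj tB tb) (left_lend2_eval_sur tB tb).
exact: lend_comul_exists (right_lend2_eval_inj tB tb) (right_lend2_eval_sur tB tb).
Qed.

End Coproduct.

(** * Transposition of endomorphisms *)

Section AntiIsomorphism.

Variables (k : fieldType) (C D : coalgType k) (g : coalgHom C D).
Local Notation f := (dual_hom g).
Local Notation A := (dual C).
Local Notation R := (subvs_of (centralizer f)).
Local Notation E := (rend g).
Local Notation S := (lend f).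
Local Notation E2 := (rend2 g).
Local Notation S2 := (lend2 f).
Local Notation lfn := (@lend_fun _ _ _ f).
Local Notation rfn := (@rend_fun _ _ _ g).
Local Notation etens := (rtmul (@rend_ract _ _ _ g) (@rend_lact _ _ _ g)).
Local Notation stens := (rtmul (@lend_ract _ _ _ f) (@lend_lact _ _ _ f)).

Let idp : 'Hom(A, 'Hom(C, k^o)) := \1%VF.

Let idpP : @dual_pair _ _ _ (corestr g g) (restr f f) idp.
Proof. by apply: corestr_dual_pair => d; apply: dual_mapE. Qed.

Lemma rend_ext (a b : E) : (forall c, rfn a c = rfn b c) -> a = b.
Proof. by move=> ab; apply: val_inj; apply/lfunP. Qed.

Lemma rend_funP a (u v : E) c : rfn (a *: u + v) c = a *: rfn u c + rfn v c.
Proof. by rewrite /rend_fun linearP add_lfunE scale_lfunE. Qed.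

Lemma transpose_mem (alpha : E) :
  (transp idp idp (rfn alpha) : 'End(restr f f)) \in bimod_end (restr f f).
Proof.
apply/bimod_endP.
apply/(adjoint_hom idpP idpP (transpP idp (rfn alpha) (perfect_id C))).
by apply/bicomod_endP; apply: subvsP.
Qed.

Lemma transposeV_mem (alpha : S) :
  (transp (lflip idp) (lflip idp) (lfn alpha) : 'End(corestr g g))
    \in bicomod_end (corestr g g).
Proof.
apply/bicomod_endP.
apply/(adjoint_hom idpP idpP (transp_flipP idp (lfn alpha) (perfect_id C))).
by apply/bimod_endP; apply: subvsP.
Qed.

Let tr (alpha : E) : S := Subvs (transpose_mem alpha).

Let trE alpha (x : A) c : lfn (tr alpha) x c = x (rfn alpha c).
Proof.
have := transpP idp (rfn alpha) (perfect_id C) x c.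
by rewrite !id_lfunE.
Qed.

Fact transpose_is_linear : linear tr.
Proof.
move=> a u v; apply: lend_ext => x; apply/lfunP => c.
by rewrite lend_funP add_lfunE scale_lfunE !trE rend_funP linearP.
Qed.

Definition transpose : 'Hom(E, S) := linfun tr.

Definition transposeV (alpha : S) : E := Subvs (transposeV_mem alpha).

Lemma transposeE alpha (x : A) c : lfn (transpose alpha) x c = x (rfn alpha c).
Proof. by rewrite (linfunE transpose_is_linear) trE. Qed.

Lemma transposeVE alpha (x : A) c : x (rfn (transposeV alpha) c) = lfn alpha x c.
Proof.
have := transp_flipP idp (lfn alpha) (perfect_id C) x c.
by rewrite !id_lfunE.
Qed.

Lemma transposeK : cancel transpose transposeV.
Proof.
move=> alpha; apply: rend_ext => c; apply: dual_separates => x.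
by rewrite transposeVE transposeE.
Qed.

Lemma transposeVK : cancel transposeV transpose.
Proof.
move=> alpha; apply: lend_ext => x; apply/lfunP => c.
by rewrite transposeE transposeVE.
Qed.

Lemma transpose_mul alpha beta :
  transpose (rend_mul alpha beta) = lend_mul (transpose beta) (transpose alpha).
Proof.
apply: lend_ext => x; apply/lfunP => c.
rewrite transposeE {1}/rend_fun /= comp_lfunE.
rewrite [in RHS]/lend_fun /= comp_lfunE.
by rewrite [RHS](transposeE beta) [RHS](transposeE alpha).
Qed.

Lemma transpose_tgt r : transpose (rend_tgt r) = lend_src r.
Proof.
apply: lend_ext => x; apply/lfunP => c; rewrite transposeE [in RHS]/lend_fun /=.
by rewrite lmulE -dual_lhit.
Qed.

Lemma transpose_src r : transpose (rend_src r) = lend_tgt r.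
Proof.
apply: lend_ext => x; apply/lfunP => c; rewrite transposeE [in RHS]/lend_fun /=.
by rewrite rmulE -dual_rhit.
Qed.

Lemma transpose_one : transpose (rend_one g) = lend_one f.
Proof.
apply: lend_ext => x; apply/lfunP => c; rewrite transposeE.
by rewrite {1}/rend_fun [in RHS]/lend_fun /= !id_lfunE.
Qed.

Lemma transpose_lact r alpha :
  transpose (rend_lact r alpha) = lend_lact r (transpose alpha).
Proof. by rewrite /rend_lact transpose_mul transpose_tgt. Qed.

Lemma transpose_ract alpha r :
  transpose (rend_ract alpha r) = lend_ract (transpose alpha) r.
Proof. by rewrite /rend_ract transpose_mul transpose_src. Qed.

Lemma transpose_counit alpha : lend_counit (transpose alpha) = rend_counit alpha.
Proof.
apply: val_inj; apply/lfunP => c.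
by rewrite [LHS]transposeE [RHS]comp_lfunE.
Qed.

Let T2 : 'Hom(E2, S2) := rtens_map transpose.

Let T2E alpha beta : T2 (etens alpha beta) = stens (transpose alpha) (transpose beta).
Proof.
apply: (rliftE (@rend_ract_bilin _ _ _ g) (@rend_lact_bilin _ _ _ g)).
  have [sl sr] := @stens_bilin _ _ _ f.
  by apply: bilinP => [a u v w|a u v w]; rewrite linearP ?sl ?sr.
by move=> a r b; rewrite transpose_ract transpose_lact stens_bal.
Qed.

Let T2V : 'Hom(S2, E2) :=
  rlift (@lend_ract _ _ _ f) (@lend_lact _ _ _ f)
    (fun a b => etens (transposeV a) (transposeV b)).

Let T2VE a b : T2V (stens a b) = etens (transposeV a) (transposeV b).
Proof.
have VL : linear transposeV.
  move=> c u v; apply: (can_inj transposeK).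
  by rewrite transposeVK linearP /= !transposeVK.
apply: (rliftE (@lend_ract_bilin _ _ _ f) (@lend_lact_bilin _ _ _ f)).
  have [sl sr] : bilin etens by apply: rtmul_bilin.
  by apply: bilinP => [c u v w|c u v w]; rewrite VL ?sl ?sr.
move=> u r v.
have -> : transposeV (lend_ract u r) = rend_ract (transposeV u) r.
  by apply: (can_inj transposeK); rewrite transpose_ract !transposeVK.
have -> : transposeV (lend_lact r v) = rend_lact r (transposeV v).
  by apply: (can_inj transposeK); rewrite transpose_lact !transposeVK.
exact: (rtmul_bal (@rend_ract_bilin _ _ _ g) (@rend_lact_bilin _ _ _ g)).
Qed.

Let T2K : cancel T2 T2V.
Proof.
elim/rtens_ind => [a b|t t' IH IH']; last by rewrite !linearD /= IH IH'.
by rewrite T2E T2VE !transposeK.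
Qed.

Let T2VK : cancel T2V T2.
Proof.
elim/rtens_ind => [a b|t t' IH IH']; last by rewrite !linearD /= IH IH'.
by rewrite T2VE T2E !transposeVK.
Qed.

(** This identifies the conditions characterising the two coproducts: the
    product x y of the algebra A is evaluated at c through the comultiplication
    of c. *)
Lemma transpose_eval (t : E2) (x y : A) c :
  lend2_eval (T2 t) x y c = fmul x y (rend2_eval t c).
Proof.
elim/rtens_ind: t => [a b|t t' IH IH'].
  rewrite T2E lend2_evalE rend2_evalE fmul_tmap comp_lfunE.
  congr (fmul _ _ _); apply/lfunP=> d; rewrite comp_lfunE; exact: transposeE.
rewrite linearD lend2_evalD add_lfunE IH IH' -linearD; congr (fmul _ _ _).
by rewrite /rend2_eval linearD.
Qed.

(** The coproduct of End(^D C^D) is the one of S carried back along the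
    bijection that transposition induces on the tensor squares over R. *)
Lemma rend_comul_from_lend DS : @is_lend_comul _ _ _ f DS ->
  bialgebroids_anti_isomorphic g.
Proof.
move=> DSP; pose DE : 'Hom(E, E2) := (T2V \o DS \o transpose)%VF.
have DEE alpha : T2 (DE alpha) = DS (transpose alpha).
  have -> : DE alpha = T2V (DS (transpose alpha)).
    by rewrite comp_lfunE [LHS]comp_lfunE.
  exact: T2VK.
exists DE, DS; split=> // [alpha t|].
  have tDE : t = DE alpha <-> T2 t = DS (transpose alpha).
    by rewrite -DEE; split=> [->|/(can_inj T2K)].
  apply: iff_trans tDE (iff_trans (DSP _ _) _); split=> [tP c|tP x y].
    apply: fmul_separates => x y; rewrite -transpose_eval tP transposeE.
    exact: comp_lfunE.
  apply/lfunP=> c; rewrite transpose_eval tP transposeE.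
  by apply/esym; apply: comp_lfunE.
exists transpose; split.
- by exists transposeV; [exact: transposeK|exact: transposeVK].
- exact: transpose_mul.
- exact: transpose_one.
- exact: transpose_tgt.
- exact: transpose_src.
- exact: transpose_lact.
- exact: transpose_ract.
- by move=> alpha; rewrite -DEE.
exact: transpose_counit.
Qed.

End AntiIsomorphism.

Theorem theorem5p5 (k : fieldType) (C D : coalgType k) (g : coalgHom C D) :
  [/\ left_codepth_two g <-> left_depth_two (dual_hom g),
      right_codepth_two g <-> right_depth_two (dual_hom g)
    & left_codepth_two g \/ right_codepth_two g ->
        bialgebroids_anti_isomorphic g].
Proof.
split; [exact: left_codepth_depth|exact: right_codepth_depth|].
move=> codepth; have [|DS DSP] := @depth_two_lend_comul _ _ _ (dual_hom g).
  case: codepth => [/left_codepth_depth|/right_codepth_depth]; first by left.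
  by right.
exact: rend_comul_from_lend DSP.
Qed.
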